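(* Assume that $\nu(dx)=h(x)\,dx$ for some nonnegative function $h$ on $\mathbb{R}$ such that $I:=\{h>0\}$ is an interval and $h$ is continuous on $I$, so that conditional on $\Theta=u$ the observations have density $h(x)p_u(x)$ with respect to Lebesgue measure. Assume that either (i) for every $u\in S$, $x\mapsto h(x)p_u(x)$ is increasing on $I$, and $S^+$ is a singleton; or (ii) for every $u\in S$, $x\mapsto h(x)p_u(x)$ is decreasing on $I$, and $S^-$ is a singleton. Then for any $\pi\in(0,1)$ and any integers $n\ge m\ge 0$, the law of $\Pi_{m+1}$ under $\mathbb{P}_{m,\pi}$ (i.e. conditional on $\Pi_m=\pi$) dominates the law of $\Pi_{n+1}$ under $\mathbb{P}_{n,\pi}$ (i.e. conditional on $\Pi_n=\pi$) in convex order; consequently, $n\mapsto V(n,\pi)$ is non-decreasing for each $\pi\in(0,1)$.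
   Context: $\mathbb{N}_0=\{0,1,2,\dots\}$ and $a\wedge b=\min\{a,b\}$. Let $\nu$ be a nonzero $\sigma$-finite measure on $\mathbb{R}$. Define $B(u)=\log\int_{\mathbb{R}}e^{ux}\,\nu(dx)$, $N=\{u\in\mathbb{R}:\int_{\mathbb{R}}e^{ux}\,\nu(dx)<\infty\}$ (an interval), $N^\circ$ the interior of $N$, and for $u\in N$ let $p_u(x)=\exp\{ux-B(u)\}$. Let $\mu$ (the prior distribution) be a probability measure concentrated on $N^\circ$, with support $S$; in the claim, the monotonicity conditions involving $p_u$ for $u\in S$ are understood for $u\in S\cap N$. Fix $\theta_0\in\mathbb{R}$ and set $S^+=S\cap(\theta_0,\infty)$, $S^-=S\cap(-\infty,\theta_0]$. Assume $0<\mu(S^+)<1$, and that $\int_S e^{uy-nB(u)}\,\mu(du)<\infty$ for all $n\in\mathbb{N}_0$ and $y\in\mathbb{R}$. For $n\in\mathbb{N}_0$, $y\in\mathbb{R}$ put $$q(n,y)=\frac{\int_{S^+}e^{uy-nB(u)}\mu(du)}{\int_{S}e^{uy-nB(u)}\mu(du)},\qquad \mu_{n,y}(du)=\frac{e^{uy-nB(u)}\mu(du)}{\int_{S}e^{vy-nB(v)}\mu(dv)}.$$ For each $n$, $y\mapsto q(n,y)$ is an increasing bijection $\mathbb{R}\to(0,1)$; for $\pi\in(0,1)$, $y(n,\pi)$ denotes the unique value with $q(n,y(n,\pi))=\pi$. For $n\in\mathbb{N}_0$ and $\pi\in(0,1)$, $\mathbb{P}_{n,\pi}$ (with expectation $\mathbb{E}_{n,\pi}$)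 is the probability measure under which a random variable $\Theta$ has distribution $\mu_{n,y(n,\pi)}$ and, conditional on $\Theta=u$, the observations $X_{n+1},X_{n+2},\dots$ are independent with law $p_u(x)\,\nu(dx)$. Under $\mathbb{P}_{n,\pi}$ the posterior probability process is $\Pi_{n+k}=q\bigl(n+k,\,y(n,\pi)+X_{n+1}+\dots+X_{n+k}\bigr)$, $k\ge 0$, so that $\Pi_n=\pi$ and $\Pi_{n+k}=\mathbb{P}_{n,\pi}(\Theta>\theta_0\mid X_{n+1},\dots,X_{n+k})$. Let $c>0$ be a constant. The value function $V:\mathbb{N}_0\times(0,1)\to[0,\infty)$ is $$V(n,\pi)=\inf_{\tau}\mathbb{E}_{n,\pi}\bigl[\Pi_{n+\tau}\wedge(1-\Pi_{n+\tau})+c\tau\bigr],$$ where the infimum is over $\mathbb{N}_0$-valued stopping times $\tau$ of the filtration $(\sigma(X_{n+1},\dots,X_{n+k}))_{k\ge 0}$. A $[0,1]$-valued random variable $Z$ (or its law) dominates $Z'$ in convex order if $\mathbb{E}[f(Z)]\ge\mathbb{E}[f(Z')]$ for every convex function $f:[0,1]\to\mathbb{R}$. *)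

(* Defs.v *)
From HB Require Import structures.
From mathcomp Require Import all_boot all_order all_algebra.
From mathcomp Require Import all_classical all_reals all_analysis.

Set Implicit Arguments.
Unset Strict Implicit.
Unset Printing Implicit Defensive.

Import Order.TTheory GRing.Theory Num.Theory.
Import numFieldNormedType.Exports.

Local Open Scope classical_set_scope.
Local Open Scope ring_scope.

Section exponential_family.
Context {R : realType}.
Variable nu : {measure set (measurableTypeR R) -> \bar R}.

Definition laplace (u : R) : \bar R := (\int[nu]_x (expR (u * x))%:E)%E.

Definition natural_domain : set R := [set u | (laplace u < +oo)%E].

(* Off [natural_domain] the log-Laplace transform is +oo; here it takes the
   irrelevant value ln 0 = 0. *)
Definition logLaplace (u : R) : R := ln (fine (laplace u)).

Definition expdens (u x : R) : R := expR (u * x - logLaplace u).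

End exponential_family.

Definition msupport {R : realType}
    (mu : {measure set (measurableTypeR R) -> \bar R}) : set R :=
  [set u | forall U : set R, open U -> U u -> (0 < mu U)%E].

Section posterior.
Context {R : realType}.
Variables (nu mu : {measure set (measurableTypeR R) -> \bar R}) (theta0 : R).

Definition supp_plus : set R := msupport mu `&` [set u | theta0 < u].

Definition supp_minus : set R := msupport mu `&` [set u | u <= theta0].

Definition weight (n : nat) (y u : R) : R :=
  expR (u * y - n%:R * logLaplace nu u).

Definition post_prob (n : nat) (y : R) : R :=
  (\int[mu]_(u in supp_plus) weight n y u) /
  (\int[mu]_(u in msupport mu) weight n y u).

Definition post_density (n : nat) (y u : R) : R :=
  weight n y u / \int[mu]_(v in msupport mu) weight n y v.

(* The unique y with [post_prob n y = p]. *)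
Definition level (n : nat) (p : R) : R :=
  xget 0 [set y | post_prob n y = p].

End posterior.

Section sequential_model.
Context {R : realType}.
Variables (nu mu : {measure set (measurableTypeR R) -> \bar R}) (theta0 : R).
Context {d : measure_display} {Omega : measurableType d}.
Variables (Theta : {mfun Omega >-> measurableTypeR R}).
(* [X i] is the i-th observation, i >= 1; [X 0] is never used. *)
Variables (X : nat -> {mfun Omega >-> measurableTypeR R}).

(* Joint law of Theta and X_(n+1), ..., X_(n+k): Theta has density
   [post_density n (level n p)] with respect to mu and, given Theta = u, the
   observations are independent with law p_u(x) nu(dx). *)
Definition bayes_model (n : nat) (p : R) (P : probability Omega R) : Prop :=
  forall (k : nat) (A : set (measurableTypeR R))
         (C : nat -> set (measurableTypeR R)),
    measurable A -> (forall i, measurable (C i)) ->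
    P (Theta @^-1` A `&` \bigcap_(i in `I_k) (X (n + i).+1 @^-1` C i)) =
    (\int[mu]_(u in A)
       (post_density nu mu n (level nu mu theta0 n p) u *
        \prod_(i < k) (\int[nu]_(x in C i) expdens nu u x)%R)%:E)%E.

(* [posterior_process n p k] is Pi_(n+k) under P_(n,p). *)
Definition posterior_process (n : nat) (p : R) (k : nat) (w : Omega) : R :=
  post_prob nu mu theta0 (n + k)
    (level nu mu theta0 n p + \sum_(i < k) X (n + i).+1 w).

Definition obs_sigma_algebra (n k : nat) : set (set Omega) :=
  <<s \bigcup_(i in `I_k) preimage_set_system setT (X (n + i).+1) measurable >>.

Definition stopping_time (n : nat) (tau : Omega -> nat) : Prop :=
  forall k, obs_sigma_algebra n k [set w | (tau w <= k)%N].

Definition value (c : R) (P : nat -> R -> probability Omega R)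
    (n : nat) (p : R) : \bar R :=
  ereal_inf [set 'E_(P n p) [(fun w =>
      Num.min (posterior_process n p (tau w) w)
              (1 - posterior_process n p (tau w) w)
      + c * (tau w)%:R)%R] | tau in stopping_time n]%E.

End sequential_model.

(* [Z] and [Z'] are meant to be [0, 1]-valued: only the restriction of [f] to
   [0, 1] matters. *)
Definition convex_dominates {R : realType} {d d' : measure_display}
    {T : measurableType d} {T' : measurableType d'}
    (P : probability T R) (Z : T -> R)
    (P' : probability T' R) (Z' : T' -> R) : Prop :=
  forall f : R -> R, @convex_function R R^o `[0, 1]%classic f ->
    ('E_P' [f \o Z'] <= 'E_P [f \o Z])%E.

(* Main.v *)
(** Let [Kp] and [Km] be the parts of the support of the prior lying in the
    natural domain, to the right and to the left of [theta0], and let [a(x)] and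
    [b(x)] be the predictive densities of the next observation jointly with
    [Theta > theta0] and [Theta <= theta0]. The next posterior probability is
    [a / (a + b)] and the observation has density [a + b], so the expectation of
    a convex [F] at the next posterior probability is the integral of the
    perspective [(a + b) F(a / (a + b))].

    Compare times [m <= n] at the same posterior probability. Since the
    log-Laplace transform is convex, the logarithm of the posterior density of
    [Theta] at time [m] minus that at time [n] is convex in [Theta]; both give
    the same mass to [Kp] and to [Km], so on each of these sides the posterior at
    time [m] puts its mass further away from [theta0]. Exponential families have
    monotone likelihood ratios, hence [a / (a + b)] is monotone in [x] and moving
    mass outwards increases the integral of the perspective.

    For the value function, backward induction shows that the optimal cost with
    at most [N] further observations is concave in the posterior probability and
    monotone in the time. A stopping time [tau] costs at least this much up to
    the probability that [tau > N], which tends to 0. *)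

Require Import Defs.
From HB Require Import structures.
From mathcomp Require Import all_boot all_order all_algebra.
From mathcomp Require Import all_classical all_reals all_analysis.
From mathcomp Require Import measurable_realfun ring lra.

Set Implicit Arguments.
Unset Strict Implicit.
Unset Printing Implicit Defensive.

Import Order.TTheory GRing.Theory Num.Theory.
Import numFieldNormedType.Exports.

Local Open Scope classical_set_scope.
Local Open Scope ring_scope.

(** The comparison [spread_perspective_le] is used twice: between two times, and between a posterior
    and a mixture of two posteriors. Its input is therefore not log-convexity but the weaker
    property shared by both cases: within the natural domain, the parameters at which the spread
    density is at most the other one form an interval. Equal masses make this interval meet both
    sides of [theta0], so on each side the two densities cross only once, and the exponential kernel
    carries a single crossing over to the predictive densities.

    Expectations at two times can be ordered only for convex functions of the posterior probability,
    so the induction for the value function has to carry concavity along with monotonicity.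
    Concavity is the second use of the comparison, and it also yields measurability of the Bellman
    functions.

    The model prescribes only probabilities of rectangles, while stopping times require the Markov
    property relative to the observations. It is derived for the state formed by the time and the
    running sum, with every identity integrated over past events instead of conditioned. *)

Section convexity_on_unit_interval.

(** * Convex functions on the open unit interval and their perspectives *)

Context {R : realType}.
Implicit Types (F : R -> R) (a b r s t : R).

(** Endpoints are excluded because posterior probabilities never reach 0 or 1, and [level] is
    meaningful only strictly between them. *)
Definition convex01 F := forall a b t, 0 < a < 1 -> 0 < b < 1 -> 0 <= t <= 1 ->
  F (t * a + (1 - t) * b) <= t * F a + (1 - t) * F b.

Lemma conv01 a b t : 0 < a < 1 -> 0 < b < 1 -> 0 <= t <= 1 ->
  0 < t * a + (1 - t) * b < 1.
Proof.
move=> /andP[a0 a1] /andP[b0 b1] /andP[t0 t1].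
by apply/andP; split; have [ab|/ltW ba] := leP a b; nra.
Qed.

(** The three-point inequality with denominators cleared, a form that polynomial arithmetic can use
    directly. *)
Lemma convex01_slope F a b r : convex01 F -> 0 < a -> a < r -> r < b -> b < 1 ->
  F r * (b - a) <= (b - r) * F a + (r - a) * F b.
Proof.
move=> cF a0 ar rb b1.
have ba : 0 < b - a by lra.
have /= := cF a b ((b - r) / (b - a)).
have -> : (b - r) / (b - a) * a + (1 - (b - r) / (b - a)) * b = r.
  by field; lra.
have -> : (b - r) / (b - a) * F a + (1 - (b - r) / (b - a)) * F b =
  ((b - r) * F a + (r - a) * F b) / (b - a) by field; lra.
move=> H; rewrite -ler_pdivlMr//; apply: H; [lra|lra|].
by rewrite divr_ge0 ?ler_pdivrMr//=; lra.
Qed.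

(** The slope is the supremum of the chord slopes to the left of [r]; every chord slope to the right
    of [r] is an upper bound of them. *)
Lemma convex01_subgradient F r : convex01 F -> 0 < r < 1 ->
  exists s, forall x, 0 < x < 1 -> F r + s * (x - r) <= F x.
Proof.
move=> cF /andP[r0 r1].
pose E := [set (F r - F x) / (r - x) | x in [set x | 0 < x < r]].
have Eub x : r < x -> x < 1 -> ubound E ((F x - F r) / (x - r)).
  move=> rx x1 _ [y /andP[y0 yr] <-].
  rewrite ler_pdivrMr ?subr_gt0// mulrAC ler_pdivlMr ?subr_gt0//.
  by have := convex01_slope cF y0 yr rx x1; nra.
have E0 : has_sup E.
  split; first by exists ((F r - F (r / 2)) / (r - r / 2)), (r / 2) => //=; lra.
  by exists ((F ((1 + r) / 2) - F r) / ((1 + r) / 2 - r)); apply: Eub; lra.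
exists (sup E) => x /andP[x0 x1].
have [xr|rx|->] := ltgtP x r; last by rewrite subrr mulr0 addr0.
- have : (F r - F x) / (r - x) <= sup E.
    by apply: sup_upper_bound => //; exists x => //=; rewrite x0.
  by rewrite ler_pdivrMr ?subr_gt0//; lra.
- have : sup E <= (F x - F r) / (x - r).
    by apply: ge_sup; [exact: (proj1 E0)|exact: Eub].
  by rewrite ler_pdivlMr ?subr_gt0//; lra.
Qed.

(** Sublevel sets of a convex function are intervals, so no continuity is involved. *)
Lemma measurable_convex01 F : convex01 F ->
  measurable_fun (`]0, 1[%classic : set R) F.
Proof.
move=> cF; apply: (measurability _ (RGenInftyO.measurableE R)).
move=> _ [_ [t ->] <-]; apply: is_interval_measurable.
move=> a b /= [+ aF] [+ bF] r; rewrite /= !in_itv/= in aF bF *.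
move=> /andP[a0 a1] /andP[b0 b1] /andP[].
rewrite le_eqVlt => /predU1P[<-//|ar]; first by rewrite a0 a1.
rewrite le_eqVlt => /predU1P[->//|rb]; first by rewrite b0 b1.
split; first lra.
have := convex01_slope cF a0 ar rb b1; nra.
Qed.

Definition perspective F a b := (a + b) * F (a / (a + b)).

Lemma ratio01 a b : 0 < a -> 0 < b -> 0 < a / (a + b) < 1.
Proof. by move=> a0 b0; rewrite divr_gt0 ?ltr_pdivrMr//=; lra. Qed.

(* With [G := F - (affine minorant touching F at r)], which is convex,
   nonnegative and vanishes at [r], the claim is monotonicity of
   [b |-> (a + b) * G (a / (a + b))] on either side of [r]. *)
Lemma perspective_le F r s a b1 b2 : convex01 F -> 0 < r < 1 ->
  (forall x, 0 < x < 1 -> F r + s * (x - r) <= F x) ->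
  0 < a -> 0 < b1 -> 0 < b2 ->
  (b1 <= b2) && (a / (a + b1) <= r) || (b2 <= b1) && (r <= a / (a + b1)) ->
  perspective F a b1 + (F r - s * r) * (b2 - b1) <= perspective F a b2.
Proof.
move=> cF r01 sF a0 b10 b20 + ; rewrite /perspective.
set r1 := a / (a + b1); set r2 := a / (a + b2) => bbrr.
have E1 : r1 * (a + b1) = a by rewrite /r1; field; lra.
have E2 : r2 * (a + b2) = a by rewrite /r2; field; lra.
have r101 : 0 < r1 < 1 by exact: ratio01.
have r201 : 0 < r2 < 1 by exact: ratio01.
have s1 := sF _ r101; have s2 := sF _ r201.
pose G x := F x - F r - s * (x - r).
have G1 : 0 <= G r1 by rewrite /G; lra.
have G2 : 0 <= G r2 by rewrite /G; lra.
have -> : F r1 = G r1 + F r + s * (r1 - r) by rewrite /G; ring.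
have -> : F r2 = G r2 + F r + s * (r2 - r) by rewrite /G; ring.
(* The affine minorant contributes [(F r - s * r) * (a + b) + s * a] to a perspective, which
   accounts for the correction term of the statement; only the excess [G] remains. *)
suff : (a + b1) * G r1 <= (a + b2) * G r2.
  have e1 : (a + b1) * (s * r1) = s * a by rewrite -[in RHS]E1; ring.
  have e2 : (a + b2) * (s * r2) = s * a by rewrite -[in RHS]E2; ring.
  lra.
move: r01 r101 r201 => /andP[rgt0 rlt1] /andP[r1gt0 r1lt1] /andP[r2gt0 r2lt1].
have [b12|b12] := eqVneq b1 b2; first by rewrite /r1 b12.
case/orP: bbrr => /andP[bb rr].
(* Here [r2 < r1 <= r]: left of its zero [r] the excess [G] is nonincreasing, and the total [a + b]
   grows as well. *)
- have {bb b12}bb : b1 < b2 by rewrite lt_neqAle b12.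
  have r21 : r2 < r1 by nra.
  have [r1r|r1r] := eqVneq r1 r.
    rewrite {1}/G r1r; nra.
  have {}r1r : r1 < r by rewrite lt_neqAle r1r.
  have := @convex01_slope F r2 r r1 cF.
  have -> : F r1 = G r1 + F r + s * (r1 - r) by rewrite /G; ring.
  have -> : F r2 = G r2 + F r + s * (r2 - r) by rewrite /G; ring.
  move=> H.
  have {}H : G r1 * (r - r2) <= (r - r1) * G r2.
    by have := H r2gt0 r21 r1r rlt1; nra.
  have GG : G r1 <= G r2 by rewrite -(@ler_pM2r _ (r - r2)) ?subr_gt0; nra.
  nra.
- have {bb b12}bb : b2 < b1 by rewrite lt_neqAle eq_sym b12.
  have r12 : r1 < r2 by nra.
  have [r1r|r1r] := eqVneq r1 r.
    rewrite {1}/G r1r; nra.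
  have {}r1r : r < r1 by rewrite lt_neqAle eq_sym r1r.
  have := @convex01_slope F r r2 r1 cF.
  have -> : F r1 = G r1 + F r + s * (r1 - r) by rewrite /G; ring.
  have -> : F r2 = G r2 + F r + s * (r2 - r) by rewrite /G; ring.
  move=> H.
  have {}H : G r1 * (r2 - r) <= (r1 - r) * G r2.
    by have := H rgt0 r1r r12 r2lt1; nra.
  (* The two sides are [a - r * (a + b1)] and [a - r * (a + b2)]. Right of [r], the quotient
     [G x / (x - r)] is nondecreasing, and the two facts multiply. *)
  have H2 : (a + b1) * (r1 - r) <= (a + b2) * (r2 - r) by nra.
  rewrite -(@ler_pM2r _ (r2 - r)) ?subr_gt0; last lra.
  nra.
Qed.

(** Dividing by the total [d] of the combination reduces joint convexity to convexity of [F] with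
    weights [t * c / d] and [(1 - t) * c' / d]. *)
Lemma perspective_convex F t a b a' b' : convex01 F -> 0 <= t <= 1 ->
  0 < a -> 0 < b -> 0 < a' -> 0 < b' ->
  perspective F (t * a + (1 - t) * a') (t * b + (1 - t) * b') <=
  t * perspective F a b + (1 - t) * perspective F a' b'.
Proof.
move=> cF /andP[t0 t1] a0 b0 a'0 b'0; rewrite /perspective.
set c := a + b; set c' := a' + b'.
have c0 : 0 < c by rewrite /c; lra.
have c'0 : 0 < c' by rewrite /c'; lra.
have -> : t * a + (1 - t) * a' + (t * b + (1 - t) * b') = t * c + (1 - t) * c'.
  by rewrite /c /c'; ring.
set d := t * c + (1 - t) * c'.
have d0 : 0 < d by rewrite /d; nra.
have e : 1 - t * c / d = (1 - t) * c' / d by rewrite /d; field; nra.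
have -> : (t * a + (1 - t) * a') / d =
    (t * c / d) * (a / c) + (1 - t * c / d) * (a' / c').
  by rewrite e; field; rewrite !gt_eqF.
have -> : t * (c * F (a / c)) + (1 - t) * (c' * F (a' / c')) =
    d * (t * c / d * F (a / c) + (1 - t * c / d) * F (a' / c')).
  by rewrite e; field; rewrite gt_eqF.
rewrite ler_pM2l//; apply: cF; [exact: ratio01|exact: ratio01|].
rewrite divr_ge0 ?ler_pdivrMr//= ?mul1r /d; nra.
Qed.

(** Reflecting [F] exchanges the two hypotheses, so results on varying the second argument also
    serve for the first. *)
Lemma perspective_swap F a b :
  0 < a -> 0 < b -> perspective (fun r => F (1 - r)) b a = perspective F a b.
Proof.
move=> a0 b0; rewrite /perspective addrC; congr (_ * F _).
by field; lra.
Qed.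

Lemma convex01_swap F : convex01 F -> convex01 (fun r => F (1 - r)).
Proof.
move=> cF a b t a01 b01 t01.
have -> : 1 - (t * a + (1 - t) * b) = t * (1 - a) + (1 - t) * (1 - b) by ring.
by apply: cF => //; lra.
Qed.

End convexity_on_unit_interval.

(** * Real-valued integrals: linearity, domination and strict positivity *)

Section real_integrals.
Context {R : realType} {d : measure_display} {T : measurableType d}.
Variable m : {measure set T -> \bar R}.
Implicit Types (D : set T) (f g : T -> R).

Lemma measurable_fun_div f g : measurable_fun setT f -> measurable_fun setT g ->
  (forall x, 0 < g x) -> measurable_fun setT (fun x => f x / g x).
Proof.
move=> mf mg g0; apply: measurable_funM => //.
rewrite (_ : (fun x => _) = (fun x => expR (- ln (g x)))); last first.
  by apply/funext => x; rewrite expRN lnK ?posrE.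
apply: measurableT_comp => //; apply: measurable_funN => //.
exact: measurableT_comp.
Qed.

Lemma ge0_integral_lincomb (a b : R) f g : 0 <= a -> 0 <= b ->
  measurable_fun setT f -> measurable_fun setT g ->
  (forall x, 0 <= f x) -> (forall x, 0 <= g x) ->
  (\int[m]_x (a * f x + b * g x)%:E =
   a%:E * (\int[m]_x (f x)%:E) + b%:E * (\int[m]_x (g x)%:E))%E.
Proof.
move=> a0 b0 mf mg f0 g0.
under eq_integral do rewrite EFinD.
rewrite ge0_integralD//.
- congr (_ + _)%E; under eq_integral do rewrite EFinM.
    rewrite ge0_integralZl_EFin//; last exact/measurable_EFinP.
    by move=> x _; rewrite lee_fin.
  rewrite ge0_integralZl_EFin//; last exact/measurable_EFinP.
  by move=> x _; rewrite lee_fin.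
- by move=> x _; rewrite lee_fin mulr_ge0.
- by apply/measurable_EFinP; exact: measurable_funM.
- by move=> x _; rewrite lee_fin mulr_ge0.
- by apply/measurable_EFinP; exact: measurable_funM.
Qed.

Lemma integrable_EFinD D f g : measurable D ->
  m.-integrable D (EFin \o f) -> m.-integrable D (EFin \o g) ->
  m.-integrable D (EFin \o (fun x => f x + g x)).
Proof. by move=> mD; exact: integrableD. Qed.

Lemma integrable_EFinB D f g : measurable D ->
  m.-integrable D (EFin \o f) -> m.-integrable D (EFin \o g) ->
  m.-integrable D (EFin \o (fun x => f x - g x)).
Proof. by move=> mD; exact: integrableB. Qed.

Lemma integrable_EFinZ D c f : measurable D ->
  m.-integrable D (EFin \o f) -> m.-integrable D (EFin \o (fun x => c * f x)).
Proof. by move=> mD; exact: integrableZl. Qed.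

Lemma le_integrable_EFin D f g : measurable D -> measurable_fun D f ->
  (forall x, D x -> `|f x| <= g x) -> m.-integrable D (EFin \o g) ->
  m.-integrable D (EFin \o f).
Proof.
move=> mD mf fg; apply: le_integrable => //; first exact/measurable_EFinP.
move=> x Dx; rewrite /= lee_fin; apply: le_trans (fg _ Dx) (ler_norm _).
Qed.

Lemma integrable_EFin_measurable D f :
  m.-integrable D (EFin \o f) -> measurable_fun D f.
Proof. by move=> /measurable_int/measurable_EFinP. Qed.

Lemma Rintegral_eq0_ae D f : measurable D -> m.-integrable D (EFin \o f) ->
  (forall x, D x -> 0 <= f x) -> \int[m]_(x in D) f x = 0 ->
  ae_eq m D (EFin \o f) (cst 0%E).
Proof.
move=> mD fi f0 If; apply/ae_eq_integral_abs => //; first exact: measurable_int fi.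
have : (\int[m]_(x in D) (f x)%:E)%E = 0%E.
  by rewrite -[LHS]fineK ?integrable_fin_num//; congr EFin.
move=> <-; apply: eq_integral => x /[!inE] Dx.
by rewrite /= ger0_norm ?f0.
Qed.

Lemma Rintegral_gt0 D f : measurable D -> m.-integrable D (EFin \o f) ->
  (forall x, D x -> 0 < f x) -> (0 < m D)%E -> 0 < \int[m]_(x in D) f x.
Proof.
move=> mD fi f0 mD0.
have If0 : 0 <= \int[m]_(x in D) f x.
  by apply: Rintegral_ge0 => x /f0/ltW.
rewrite lt_neqAle If0 andbT eq_sym; apply/eqP => I0.
have [|N [mN N0 DN]] := Rintegral_eq0_ae mD fi _ I0.
  by move=> x /f0/ltW.
move: mD0; apply/negP; rewrite -leNgt -N0; apply: le_measure; rewrite ?inE//.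
by move=> x Dx; apply: DN => /= /(_ Dx)[] /eqP; rewrite gt_eqF ?f0.
Qed.

End real_integrals.

(** * Integrated perspectives of a pair of densities *)

Section perspective_integral.
Context {R : realType} {d : measure_display} {T : measurableType d}.
Variables (m : {measure set T -> \bar R}) (F : R -> R) (M : R).
Hypotheses (cF : convex01 F) (bF : forall r, 0 < r < 1 -> `|F r| <= M).

Lemma integrable_perspective (A B : T -> R) :
  (forall x, 0 < A x) -> (forall x, 0 < B x) ->
  m.-integrable setT (EFin \o A) -> m.-integrable setT (EFin \o B) ->
  m.-integrable setT (EFin \o (fun x => perspective F (A x) (B x))).
Proof.
move=> A0 B0 iA iB.
have mA := integrable_EFin_measurable iA.
have mB := integrable_EFin_measurable iB.
have mAB : measurable_fun setT (fun x => A x + B x) by exact: measurable_funD.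
apply: (@le_integrable_EFin _ _ _ _ _ _ (fun x => M * (A x + B x))) => //.
- apply: measurable_funM => //.
  apply: (@measurable_comp _ _ _ _ _ _ (`]0, 1[%classic : set R) F setT
    (fun x => A x / (A x + B x))) => //.
  + by move=> _ [x _ <-]; rewrite /= in_itv/= ratio01.
  + exact: measurable_convex01.
  + by apply: measurable_fun_div => // x; rewrite addr_gt0.
- move=> x _; have AB0 : 0 < A x + B x by rewrite addr_gt0.
  rewrite /perspective normrM (gtr0_norm AB0) mulrC ler_pM2r//.
  by apply: bF; exact: ratio01.
- by apply: integrable_EFinZ => //; exact: integrable_EFinD.
Qed.

(* [r0] separates the posterior probabilities at points where [B1 < B2] from
   those at points where [B2 < B1]; the affine function touching [F] at [r0] has
   the same integral on both sides. *)
Lemma perspective_integral_le (A B1 B2 : T -> R) :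
  (forall x, 0 < A x) -> (forall x, 0 < B1 x) -> (forall x, 0 < B2 x) ->
  m.-integrable setT (EFin \o A) ->
  m.-integrable setT (EFin \o B1) -> m.-integrable setT (EFin \o B2) ->
  \int[m]_x B1 x = \int[m]_x B2 x ->
  (forall x x', B1 x < B2 x -> B2 x' < B1 x' ->
    A x / (A x + B1 x) <= A x' / (A x' + B1 x')) ->
  \int[m]_x perspective F (A x) (B1 x) <= \int[m]_x perspective F (A x) (B2 x).
Proof.
move=> A0 B10 B20 iA iB1 iB2 I12 sep.
(* If one density dominates the other, equal integrals make them agree almost everywhere. This
   settles the cases in which one of the two regions [B1 < B2] and [B2 < B1] is empty. *)
have eq_case (f g : T -> R) : (forall x, 0 < f x) -> (forall x, 0 < g x) ->
    m.-integrable setT (EFin \o f) -> m.-integrable setT (EFin \o g) ->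
    \int[m]_x f x = \int[m]_x g x -> (forall x, f x <= g x) ->
    \int[m]_x perspective F (A x) (f x) = \int[m]_x perspective F (A x) (g x).
  move=> f0 g0 iF iG Ifg fg; rewrite /Rintegral; congr fine.
  apply: ae_eq_integral => //.
  - exact: (measurable_int m (integrable_perspective _ _ iA iF)).
  - exact: (measurable_int m (integrable_perspective _ _ iA iG)).
  have := @Rintegral_eq0_ae _ _ _ m setT (fun x => g x - f x) measurableT.
  case.
  - exact: integrable_EFinB.
  - by move=> x _; rewrite subr_ge0.
  - by rewrite RintegralB// Ifg subrr.
  move=> N [mN N0 NN]; exists N; split => // x /= H; apply: NN => /= H'.
  apply: H => _; congr (_%:E); congr (perspective F _ _).
  by have /= [/eqP] := H' I; rewrite subr_eq0 => /eqP.
have [B12|/existsNP[x1 /negP]] := pselect (forall x, B2 x <= B1 x).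
  by rewrite (eq_case B2 B1).
rewrite -ltNge => x1P.
have [B21|/existsNP[x2 /negP]] := pselect (forall x, B1 x <= B2 x).
  by rewrite (eq_case B1 B2).
rewrite -ltNge => x2P.
pose r1 x := A x / (A x + B1 x).
pose E := [set r1 x | x in [set x | B1 x < B2 x]].
have E0 : has_sup E.
  split; first by exists (r1 x1), x1.
  by exists (r1 x2) => _ [x /= xP <-]; exact: sep.
have Eub x : B1 x < B2 x -> r1 x <= sup E.
  by move=> xP; apply: sup_upper_bound => //; exists x.
have Elb x : B2 x < B1 x -> sup E <= r1 x.
  move=> xP; apply: ge_sup; first exact: (proj1 E0).
  by move=> _ [y /= yP <-]; exact: sep.
(* Both regions are now inhabited: the ratio at [x1] keeps the threshold above 0, the ratio at [x2]
   keeps it below 1. *)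
have r01 : 0 < sup E < 1.
  have /andP[a0 _] := ratio01 (A0 x1) (B10 x1).
  have /andP[_ a1] := ratio01 (A0 x2) (B10 x2).
  by rewrite (lt_le_trans a0 (Eub _ x1P)) (le_lt_trans (Elb _ x2P) a1).
have [s sP] := convex01_subgradient cF r01.
set k := F (sup E) - s * sup E.
(* The added term has integral zero because [B1] and [B2] have equal mass; with it the inequality
   holds pointwise. *)
have -> : \int[m]_x perspective F (A x) (B1 x) =
    \int[m]_x (perspective F (A x) (B1 x) + k * (B2 x - B1 x)).
  rewrite RintegralD ?RintegralZl ?RintegralB ?I12 ?subrr ?mulr0 ?addr0//.
  - exact: integrable_EFinB.
  - exact: integrable_perspective.
  - by apply: integrable_EFinZ => //; exact: integrable_EFinB.
apply: le_Rintegral => //.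
- apply: integrable_EFinD => //; first exact: integrable_perspective.
  by apply: integrable_EFinZ => //; exact: integrable_EFinB.
- exact: integrable_perspective.
- move=> x _; have [xP|xP|->] := ltgtP (B1 x) (B2 x).
  + by apply: perspective_le => //; rewrite (ltW xP) Eub.
  + by apply: perspective_le => //; rewrite (ltW xP) (Elb _ xP) orbT.
  + by rewrite subrr mulr0 addr0.
Qed.

End perspective_integral.

(** * The Laplace transform of [nu] and convexity of its logarithm *)

Section exponential_family_facts.
Context {R : realType}.
Variable nu : {sigma_finite_measure set (measurableTypeR R) -> \bar R}.
Hypothesis nu_neq0 : nu [set: R] <> 0%E.
Local Notation B := (logLaplace nu).
Local Notation N := (natural_domain nu).

Lemma measurable_expR_affine (a b : R) :
  measurable_fun [set: measurableTypeR R] (fun x : R => expR (a * x + b)).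
Proof.
by apply: measurableT_comp => //; apply: measurable_funD.
Qed.

Lemma measurable_expdens u :
  measurable_fun [set: measurableTypeR R] (expdens nu u).
Proof. exact: measurable_expR_affine. Qed.

Lemma measurable_expRZ u :
  measurable_fun [set: measurableTypeR R] (fun x : R => expR (u * x)).
Proof.
have := measurable_expR_affine u 0.
by under eq_fun do rewrite addr0.
Qed.

Lemma laplace_gt0 u : (0 < laplace nu u)%E.
Proof.
rewrite lt_neqAle eq_sym integral_ge0 ?andbT; last first.
  by move=> x _; rewrite lee_fin expR_ge0.
apply/eqP => I0; apply: nu_neq0.
have mf := measurable_expRZ u.
have [|I1 _] := @ae_eq_integral_abs _ _ _ nu setT measurableT
    (fun x : R => (expR (u * x))%:E).
  exact/measurable_EFinP.
case: I1 => [|Z [mZ Z0 ZP]].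
  rewrite -[RHS]I0; apply: eq_integral => x _.
  by rewrite /= ger0_norm ?expR_ge0.
apply/eqP; rewrite -measure_le0 -Z0; apply: le_measure; rewrite ?inE//.
by move=> x _; apply: ZP => /= /(_ I)[] /eqP; rewrite gt_eqF ?expR_gt0.
Qed.

Lemma expR_logLaplace u : N u -> (expR (B u))%:E = laplace nu u.
Proof.
move=> Nu; rewrite /logLaplace lnK ?fineK ?posrE//.
- by rewrite ge0_fin_numE ?ltW ?laplace_gt0.
- by apply: fine_gt0; rewrite laplace_gt0/=.
Qed.

Lemma measurable_laplace :
  measurable_fun [set: measurableTypeR R] (laplace nu).
Proof.
have := @measurable_fun_fubini_tonelli_F _ _ (measurableTypeR R)
  (measurableTypeR R) R nu (fun z => (expR (z.1 * z.2))%:E).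
apply.
- by apply/measurable_EFinP; apply: measurableT_comp => //; exact: measurable_funM.
- by move=> x; rewrite lee_fin expR_ge0.
Qed.

Lemma measurable_logLaplace : measurable_fun [set: measurableTypeR R] B.
Proof.
by apply: measurableT_comp => //; apply: measurableT_comp => //;
  exact: measurable_laplace.
Qed.

Lemma expR_affine_integral u c :
  (\int[nu]_x (expR (u * x - c))%:E = (expR (- c))%:E * laplace nu u)%E.
Proof.
rewrite /laplace -ge0_integralZl//.
- by apply: eq_integral => x _; rewrite -EFinM -expRD addrC.
- by apply/measurable_EFinP; exact: measurable_expRZ.
Qed.

Lemma expdens_integral u : N u -> (\int[nu]_x (expdens nu u x)%:E = 1)%E.
Proof.
move=> Nu; rewrite expR_affine_integral -expR_logLaplace// -EFinM -expRD.
by rewrite addNr expR0.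
Qed.

(* Integrate the convexity inequality of [expR] between the normalised
   densities at [u] and [w]. *)
Lemma logLaplace_convex u w t : N u -> N w -> 0 <= t <= 1 ->
  N (t * u + (1 - t) * w) /\
  B (t * u + (1 - t) * w) <= t * B u + (1 - t) * B w.
Proof.
move=> Nu Nw /andP[t0 t1].
set v := t * u + _; set c := t * B u + _.
have I1 : ((expR (- c))%:E * laplace nu v <= 1)%E.
  rewrite -expR_affine_integral.
  apply: (@le_trans _ _ (\int[nu]_x
      (t * expdens nu u x + (1 - t) * expdens nu w x)%:E)%E).
    apply: ge0_le_integral => //.
    - by apply/measurable_EFinP; exact: measurable_expR_affine.
    - apply/measurable_EFinP; apply: measurable_funD;
        by apply: measurable_funM => //; exact: measurable_expdens.
    - move=> x _; rewrite lee_fin.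
      have := convex_expR (Itv01 t0 t1) (u * x - B u) (w * x - B w).
      rewrite !convRE /= /unstable.onem.
      have -> // : t * (u * x - B u) + (1 - t) * (w * x - B w) = v * x - c.
      by rewrite /v /c; move: (B u) (B w) => bu bw; ring.
  rewrite ge0_integral_lincomb ?subr_ge0//; try exact: measurable_expdens;
    try (by move=> x; exact: expR_ge0).
  rewrite [X in (_ * X + _)%E](expdens_integral Nu).
  rewrite [X in (_ + _ * X)%E](expdens_integral Nw).
  by rewrite !mule1 -EFinD lee_fin addrC subrK.
(* This single bound gives both that [v] lies in the natural domain and the estimate of [B v]. *)
have lv : (laplace nu v <= (expR c)%:E)%E.
  have : ((expR c)%:E * ((expR (- c))%:E * laplace nu v) <= (expR c)%:E * 1)%E.
    by rewrite lee_wpmul2l// lee_fin expR_ge0.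
  by rewrite muleA -EFinM -expRD subrr expR0 mul1e mule1.
have Nv : N v by rewrite /natural_domain /= (le_lt_trans lv)// ltry.
split=> //; rewrite -ler_expR -lee_fin expR_logLaplace//.
Qed.

End exponential_family_facts.

(** * The support of a probability measure has full measure *)

Section support.
Context {R : realType}.
Variable mu : probability (measurableTypeR R) R.
Local Notation S := (msupport mu).

Lemma closed_msupport : closed S.
Proof.
rewrite -openC openE => x /= Sx; rewrite /interior /=.
move: Sx => /existsNP[U] /not_implyP[oU] /not_implyP[Ux U0].
have := open_nbhs_nbhs (conj oU Ux); apply: filterS => y Uy Sy.
by apply: U0; exact: Sy.
Qed.

Lemma measurable_msupport : measurable (S : set (measurableTypeR R)).
Proof. by apply: closed_measurable; exact: closed_msupport. Qed.

(** Each point outside the support lies in a null interval with rational endpoints, and there are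
    countably many of these. In the enumeration [F], integers that code no pair, or code an interval
    of positive mass, contribute the empty set. *)
Lemma negligible_setC_msupport : mu.-negligible (~` S).
Proof.
pose F n : set (measurableTypeR R) := if unpickle n is Some (a, b) then
  let I := (`]ratr a, ratr b[%classic : set R) in
  if mu I == 0%E then I else set0 else set0.
apply: (@negligibleS _ _ _ _ (\bigcup_n F n)); last first.
  apply: negligible_bigcup => n; rewrite /F.
  case: (unpickle n) => [[a b]|] /=; last exact: negligible_set0.
  case: ifPn => [/eqP m0|_]; last exact: negligible_set0.
  by apply/negligibleP => //; exact: measurable_itv.
move=> x /existsNP[U] /not_implyP[oU] /not_implyP[Ux /negP U0].
have /nbhs_ballP[e /= e0 xU] := open_nbhs_nbhs (conj oU Ux).
have [a /[!in_itv]/= /andP[a1 a2]] := @rat_in_itvoo R (x - e) x ltac:(lra).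
have [b /[!in_itv]/= /andP[b1 b2]] := @rat_in_itvoo R x (x + e) ltac:(lra).
have IU : `]ratr a, ratr b[ `<=` U.
  move=> z /= /[!in_itv]/= /andP[az zb]; apply: xU; rewrite /ball /=.
  by rewrite ltr_norml; lra.
have mI0 : mu (`]ratr a, ratr b[%classic : set R) == 0%E.
  rewrite -measure_le0; apply: (@le_trans _ _ (mu U)); last by rewrite leNgt.
  by apply: le_measure => //; rewrite inE; [exact: measurable_itv|exact: open_measurable].
exists (pickle (a, b)); first exact: I.
rewrite /F (pickleK (a, b)) mI0.
by rewrite set_itvE /= a2 b1.
Qed.

End support.

(** * Unnormalised posterior masses on the two sides of [theta0] *)

Section prior_masses.
Context {R : realType}.
Variables (nu : {sigma_finite_measure set (measurableTypeR R) -> \bar R})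
  (mu : probability (measurableTypeR R) R) (theta0 : R).
Hypothesis mu_concentrated : mu (natural_domain nu)° = 1%E.
Hypothesis mu_plus : (0 < mu (supp_plus mu theta0) < 1)%E.
Hypothesis weight_fin : forall (n : nat) (y : R),
  (\int[mu]_(u in msupport mu) (weight nu n y u)%:E < +oo)%E.

(** A set of full prior mass on which [logLaplace] is the genuine log-Laplace transform, not its
    default value. *)
Definition carrier : set (measurableTypeR R) :=
  msupport mu `&` (natural_domain nu)°.
Definition carrier_plus := carrier `&` [set u | theta0 < u].
Definition carrier_minus := carrier `&` [set u | u <= theta0].

Lemma measurable_weight n y :
  measurable_fun [set: measurableTypeR R] (weight nu n y).
Proof.
apply: measurableT_comp => //; apply: measurable_funB.
  exact: measurable_funM.
by apply: measurable_funM => //; exact: measurable_logLaplace.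
Qed.

Lemma weight_gt0 n y u : 0 < weight nu n y u.
Proof. exact: expR_gt0. Qed.

(** Conjugacy of the family: an observation [x] moves the state [(n, y)] to [(n.+1, y + x)], so the
    count and the sum are sufficient. *)
Lemma weight_expdens n y x u :
  weight nu n y u * expdens nu u x = weight nu n.+1 (y + x) u.
Proof.
rewrite /weight /expdens -expRD; congr expR; rewrite -natr1.
by move: (logLaplace nu u) => b; ring.
Qed.

Lemma measurable_carrier : measurable carrier.
Proof.
apply: measurableI; first exact: measurable_msupport.
by apply: open_measurable; exact: open_interior.
Qed.

Lemma measurable_carrier_plus : measurable carrier_plus.
Proof.
apply: measurableI; first exact: measurable_carrier.
by rewrite -set_itvoy; exact: measurable_itv.
Qed.

Lemma measurable_carrier_minus : measurable carrier_minus.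
Proof.
apply: measurableI; first exact: measurable_carrier.
by rewrite -set_itvNyc; exact: measurable_itv.
Qed.

Lemma carrier_plus_sub : carrier_plus `<=` carrier.
Proof. by move=> ? []. Qed.

Lemma carrier_minus_sub : carrier_minus `<=` carrier.
Proof. by move=> ? []. Qed.

Lemma carrierU : carrier = carrier_plus `|` carrier_minus.
Proof.
rewrite /carrier_plus /carrier_minus -setIUr.
rewrite (_ : _ `|` _ = setT) ?setIT//; apply/seteqP; split => // u _.
by have [|] := leP u theta0; [right|left].
Qed.

Lemma disjoint_carrier : [disjoint carrier_plus & carrier_minus].
Proof.
apply/disj_setPS => u [[_ /= h1] [_ /= h2]].
by move: h1; rewrite ltNge h2.
Qed.

Lemma carrier_natural_domain : carrier `<=` natural_domain nu.
Proof. by move=> u [_]; exact: interior_subset. Qed.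

Lemma mu_setC_carrier : mu (~` carrier) = 0%E.
Proof.
apply: measure_negligible.
  by apply: measurableC; exact: measurable_carrier.
rewrite /carrier setCI; apply: negligibleU; first exact: negligible_setC_msupport.
have mN : measurable ((natural_domain nu)° : set (measurableTypeR R)).
  by apply: open_measurable; exact: open_interior.
have m0 : mu (~` (natural_domain nu)°) = 0%E.
  by rewrite probability_setC// mu_concentrated subee.
by apply/negligibleP => //; exact: measurableC.
Qed.

Lemma integral_carrier (D : set (measurableTypeR R)) (f : R -> \bar R) :
  measurable D -> measurable_fun D f -> (forall u, D u -> (0 <= f u)%E) ->
  (\int[mu]_(u in D) f u = \int[mu]_(u in D `&` carrier) f u)%E.
Proof.
move=> mD mf f0.
rewrite (ge0_negligible_integral _ _ _ _ mu_setC_carrier)//.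
  by rewrite setDE setCK.
by apply: measurableC; exact: measurable_carrier.
Qed.

Lemma measure_carrier (D : set (measurableTypeR R)) :
  measurable D -> mu D = mu (D `&` carrier).
Proof.
move=> mD; rewrite -[LHS]mul1e -[RHS]mul1e -!integral_cst//.
  by rewrite integral_carrier.
by apply: measurableI => //; exact: measurable_carrier.
Qed.

Definition mass (E : set (measurableTypeR R)) n y :=
  \int[mu]_(u in E) weight nu n y u.

Lemma integral_weight_carrier (D : set (measurableTypeR R)) n y :
  measurable D ->
  \int[mu]_(u in D) weight nu n y u = mass (D `&` carrier) n y.
Proof.
move=> mD; rewrite /mass /Rintegral integral_carrier//.
  apply/measurable_EFinP; apply: measurable_funTS; exact: measurable_weight.
by move=> u _; rewrite lee_fin ltW// weight_gt0.
Qed.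

Lemma integrable_weight (E : set (measurableTypeR R)) n y : measurable E ->
  E `<=` carrier -> mu.-integrable E (EFin \o weight nu n y).
Proof.
move=> mE EK; apply: (@integrableS _ _ _ mu (msupport mu)) => //.
- exact: measurable_msupport.
- by move=> u /EK[].
apply/integrableP; split.
  apply/measurable_EFinP; apply: measurable_funTS; exact: measurable_weight.
rewrite (le_lt_trans _ (weight_fin n y))// le_eqVlt; apply/orP; left; apply/eqP.
by apply: eq_integral => u _; rewrite /= gtr0_norm// weight_gt0.
Qed.

Lemma supp_plus_carrier : supp_plus mu theta0 `&` carrier = carrier_plus.
Proof. by apply/seteqP; split => [u [[? ?] [? ?]]|u [[? ?] ?]]. Qed.

Lemma measurable_supp_plus :
  measurable (supp_plus mu theta0 : set (measurableTypeR R)).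
Proof.
apply: measurableI; first exact: measurable_msupport.
by rewrite -set_itvoy; exact: measurable_itv.
Qed.

Lemma mu_carrier_plusE : mu carrier_plus = mu (supp_plus mu theta0).
Proof.
by have := measure_carrier measurable_supp_plus; rewrite supp_plus_carrier.
Qed.

Lemma mu_carrier_plus : (0 < mu carrier_plus)%E.
Proof. by rewrite [X in (_ < X)%E]mu_carrier_plusE; case/andP: mu_plus. Qed.

(** The carrier has mass 1 and its right part strictly less, by the upper bound in [mu_plus]. *)
Lemma mu_carrier_minus : (0 < mu carrier_minus)%E.
Proof.
have : (mu carrier = 1)%E.
  by rewrite -[carrier]setTI -measure_carrier// probability_setT.
rewrite carrierU measureU; [|exact: measurable_carrier_plus
  |exact: measurable_carrier_minus|by apply/disj_set2P; exact: disjoint_carrier].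
rewrite [X in (X + _)%E]mu_carrier_plusE; case/andP: mu_plus => _ m1 m2.
rewrite lt_neqAle measure_ge0 andbT; apply/eqP => m0.
by move: m1; rewrite -m2 -[X in (_ + X)%E]m0 adde0 ltxx.
Qed.

Lemma mass_gt0 (E : set (measurableTypeR R)) n y : measurable E ->
  E `<=` carrier -> (0 < mu E)%E -> 0 < mass E n y.
Proof.
move=> mE EK mE0; apply: Rintegral_gt0 => //; first exact: integrable_weight.
by move=> u _; exact: weight_gt0.
Qed.

Lemma mass_plus_gt0 n y : 0 < mass carrier_plus n y.
Proof.
by apply: mass_gt0 mu_carrier_plus; [exact: measurable_carrier_plus|
  exact: carrier_plus_sub].
Qed.

Lemma mass_minus_gt0 n y : 0 < mass carrier_minus n y.
Proof.
by apply: mass_gt0 mu_carrier_minus; [exact: measurable_carrier_minus|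
  exact: carrier_minus_sub].
Qed.

Lemma mass_carrier n y :
  mass carrier n y = mass carrier_plus n y + mass carrier_minus n y.
Proof.
rewrite {1}carrierU /mass Rintegral_setU//.
- exact: measurable_carrier_plus.
- exact: measurable_carrier_minus.
- by rewrite -carrierU; apply: integrable_weight => //; exact: measurable_carrier.
- exact: disjoint_carrier.
Qed.

Lemma mass_carrier_gt0 n y : 0 < mass carrier n y.
Proof. by rewrite mass_carrier addr_gt0 ?mass_plus_gt0 ?mass_minus_gt0. Qed.

Lemma integral_weight_msupport n y :
  \int[mu]_(u in msupport mu) weight nu n y u = mass carrier n y.
Proof.
rewrite integral_weight_carrier; last exact: measurable_msupport.
by congr (mass _ n y); rewrite setIidr// => u [].
Qed.

Lemma post_probE n y : post_prob nu mu theta0 n y =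
  mass carrier_plus n y / (mass carrier_plus n y + mass carrier_minus n y).
Proof.
rewrite /post_prob integral_weight_msupport mass_carrier.
rewrite integral_weight_carrier ?supp_plus_carrier//.
exact: measurable_supp_plus.
Qed.

Lemma post_prob01 n y : 0 < post_prob nu mu theta0 n y < 1.
Proof. by rewrite post_probE ratio01 ?mass_plus_gt0 ?mass_minus_gt0. Qed.

End prior_masses.

(** * Tonelli's theorem over rectangles, by restricting the integrand *)

Section tonelli_on_sets.
Context {d1 d2 : measure_display} {T1 : measurableType d1}
  {T2 : measurableType d2} {R : realType}.
Variables (m1 : {sigma_finite_measure set T1 -> \bar R})
  (m2 : {sigma_finite_measure set T2 -> \bar R}).
Variable f : T1 * T2 -> \bar R.
Hypotheses (mf : measurable_fun setT f) (f0 : forall z, (0 <= f z)%E).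

Lemma measurable_integral_in (E : set T2) : measurable E ->
  measurable_fun setT (fun x => \int[m2]_(y in E) f (x, y))%E.
Proof.
move=> mE.
have mg : measurable_fun setT (f \_ ([set: T1] `*` E)).
  have mD : measurable ([set: T1] `*` E) by apply: measurableX.
  exact: ((measurable_restrictT f mD).1 (measurable_funTS mf)).
have g0 z : (0 <= (f \_ ([set: T1] `*` E)) z)%E by rewrite patchE; case: ifP.
have := measurable_fun_fubini_tonelli_F (m2 := m2) _ mg g0.
rewrite /fubini_F; apply: eq_measurable_fun => x _.
rewrite [RHS]integral_mkcond; apply: eq_integral => y _.
by rewrite !patchE; congr (if _ then _ else _); rewrite !in_setX in_setT.
Qed.

Lemma tonelli_in (C : set T1) (E : set T2) : measurable C -> measurable E ->
  (\int[m1]_(x in C) \int[m2]_(y in E) f (x, y) =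
   \int[m2]_(y in E) \int[m1]_(x in C) f (x, y))%E.
Proof.
move=> mC mE.
have mg : measurable_fun setT (f \_ (C `*` E)).
  have mD : measurable (C `*` E) by apply: measurableX.
  exact: ((measurable_restrictT f mD).1 (measurable_funTS mf)).
have g0 z : (0 <= (f \_ (C `*` E)) z)%E by rewrite patchE; case: ifP.
have H := fubini_tonelli (m1 := m1) (m2 := m2) _ mg g0.
rewrite integral_mkcond [RHS]integral_mkcond; apply: etrans; [|apply: etrans H _].
- apply: eq_integral => x _; rewrite patchE; case: ifPn => xC.
    rewrite integral_mkcond; apply: eq_integral => y _.
    by rewrite !patchE in_setX xC.
  by apply/esym/integral0_eq => y _; rewrite patchE in_setX (negbTE xC).
- apply: eq_integral => y _; rewrite [RHS]patchE; case: ifPn => yE.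
    rewrite [RHS]integral_mkcond; apply: eq_integral => x _.
    by rewrite !patchE in_setX yE andbT.
  by apply/integral0_eq => x _; rewrite patchE in_setX (negbTE yE) andbF.
Qed.

End tonelli_on_sets.

(** * Predictive densities as mixtures of the exponential family *)

Section mixtures.
Context {R : realType}.
Variables (nu : {sigma_finite_measure set (measurableTypeR R) -> \bar R})
  (mu : probability (measurableTypeR R) R).
Hypothesis nu_neq0 : nu [set: R] <> 0%E.
Implicit Types (E C : set (measurableTypeR R)) (omega : R -> R).

Definition mixture E omega x := \int[mu]_(u in E) (omega u * expdens nu u x).

(** The last clause makes the mixture a true integral at every [x], so that the conversion to a real
    number loses nothing. *)
Definition mixing_density E omega := [/\ measurable_fun setT omega,
  forall u, 0 < omega u, mu.-integrable E (EFin \o omega) &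
  forall x, mu.-integrable E (EFin \o (fun u => omega u * expdens nu u x))].

Lemma measurable_mixture_integrand omega : measurable_fun setT omega ->
  measurable_fun [set: measurableTypeR R * measurableTypeR R]
    (fun z => omega z.2 * expdens nu z.2 z.1).
Proof.
move=> mo; apply: measurable_funM; first exact: measurableT_comp.
apply: measurableT_comp => //; apply: measurable_funB.
  exact: measurable_funM.
by apply: measurableT_comp => //; exact: measurable_logLaplace.
Qed.

Lemma mixture_gt0 E omega x : measurable E -> (0 < mu E)%E ->
  mixing_density E omega -> 0 < mixture E omega x.
Proof.
move=> mE E0 [_ o0 _ io]; apply: Rintegral_gt0 => // u _.
by rewrite mulr_gt0 ?expR_gt0.
Qed.

Lemma mixtureE E omega x : measurable E -> mixing_density E omega ->
  ((mixture E omega x)%:E =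
   \int[mu]_(u in E) (omega u * expdens nu u x)%:E)%E.
Proof.
move=> mE [_ _ _ io]; rewrite /mixture /Rintegral fineK//.
by have := integrable_fin_num mE (io x).
Qed.

Lemma measurable_mixture E omega : measurable E -> mixing_density E omega ->
  measurable_fun [set: measurableTypeR R] (mixture E omega).
Proof.
move=> mE go; apply/measurable_EFinP.
have [mo o0 _ _] := go.
have := @measurable_integral_in _ _ (measurableTypeR R) (measurableTypeR R) R mu
  (fun z => (omega z.2 * expdens nu z.2 z.1)%:E) _ _ E mE.
move=> H; apply: eq_measurable_fun (H _ _).
- by move=> x _; rewrite /= mixtureE.
- by apply/measurable_EFinP; exact: measurable_mixture_integrand.
- by move=> z; rewrite lee_fin mulr_ge0 ?expR_ge0// ltW.
Qed.

Lemma integral_mixture E C omega : measurable E -> measurable C ->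
  mixing_density E omega ->
  (\int[nu]_(x in C) (mixture E omega x)%:E =
   \int[mu]_(u in E) ((omega u)%:E * \int[nu]_(x in C) (expdens nu u x)%:E))%E.
Proof.
move=> mE mC go; have [mo o0 _ _] := go.
under eq_integral do rewrite mixtureE//.
rewrite (@tonelli_in _ _ (measurableTypeR R) (measurableTypeR R) R nu mu
  (fun z => (omega z.2 * expdens nu z.2 z.1)%:E))//=.
- apply: eq_integral => u _; under eq_integral do rewrite EFinM.
  rewrite ge0_integralZl_EFin//.
  + by move=> x _; rewrite lee_fin expR_ge0.
  + by apply/measurable_EFinP/measurable_funTS; exact: measurable_expdens.
  + exact: ltW.
- by apply/measurable_EFinP; exact: measurable_mixture_integrand.
- by move=> z; rewrite lee_fin mulr_ge0 ?expR_ge0// ltW.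
Qed.

Lemma integralT_mixture E omega : measurable E -> E `<=` natural_domain nu ->
  mixing_density E omega ->
  (\int[nu]_x (mixture E omega x)%:E = \int[mu]_(u in E) (omega u)%:E)%E.
Proof.
move=> mE EN go; rewrite integral_mixture//.
apply: eq_integral => u /[!inE] /EN Nu.
by rewrite [X in (_ * X)%E](expdens_integral nu_neq0 Nu) mule1.
Qed.

Lemma integrable_mixture E omega : measurable E -> E `<=` natural_domain nu ->
  mixing_density E omega ->
  nu.-integrable setT (EFin \o mixture E omega).
Proof.
move=> mE EN go; have [mo o0 io _] := go.
apply/integrableP; split.
  by apply/measurable_EFinP; exact: measurable_mixture.
have /integrableP[_] := io; congr (_ < _)%E.
under [LHS]eq_integral do rewrite /= gtr0_norm//.
rewrite -integralT_mixture//; apply: eq_integral => x _ /=.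
rewrite ger0_norm//; apply: Rintegral_ge0 => u _.
by rewrite mulr_ge0 ?expR_ge0// ltW.
Qed.

Lemma RintegralT_mixture E omega : measurable E -> E `<=` natural_domain nu ->
  mixing_density E omega ->
  \int[nu]_x mixture E omega x = \int[mu]_(u in E) omega u.
Proof. by move=> mE EN go; rewrite /Rintegral integralT_mixture. Qed.

(** Monotone likelihood ratio: passing from [x] to [x'] multiplies the integrand by
    [expR (u * (x' - x))], which is at least [expR (b * (x' - x))] for [u] in [E] and at most that
    for [u] in [E']. *)
Lemma mixture_ratio (E E' : set (measurableTypeR R)) omega omega' b x x' :
  measurable E -> measurable E' ->
  mixing_density E omega -> mixing_density E' omega' ->
  (forall u, E u -> b <= u) -> (forall u, E' u -> u <= b) -> x <= x' ->
  mixture E omega x * mixture E' omega' x' <=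
  mixture E omega x' * mixture E' omega' x.
Proof.
move=> mE mE' go go' Eb E'b xx'.
have [_ o0 _ io] := go; have [_ o'0 _ io'] := go'.
have H1 : expR (b * (x' - x)) * mixture E omega x <= mixture E omega x'.
  rewrite /mixture -RintegralZl//; apply: le_Rintegral => //.
    exact: integrable_EFinZ.
  move=> u /Eb bu; rewrite mulrCA ler_pM2l// /expdens -expRD ler_expR.
  move: (logLaplace nu u) => l; nra.
have H2 : mixture E' omega' x' <= expR (b * (x' - x)) * mixture E' omega' x.
  rewrite /mixture -RintegralZl//; apply: le_Rintegral => //.
    exact: integrable_EFinZ.
  move=> u /E'b bu; rewrite mulrCA ler_pM2l// /expdens -expRD ler_expR.
  move: (logLaplace nu u) => l; nra.
apply: le_trans (ler_wpM2r _ H1); last first.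
  by apply: Rintegral_ge0 => u _; rewrite mulr_ge0 ?expR_ge0// ltW.
rewrite mulrAC [leRHS]mulrC.
apply: ler_wpM2l; last exact: H2.
by apply: Rintegral_ge0 => u _; rewrite mulr_ge0 ?expR_ge0// ltW.
Qed.

(* [expR (- b * x) * (mixture E omega2 x - mixture E omega1 x)] is
   nonincreasing in [x]. *)
Lemma mixture_crossing E omega1 omega2 b x x' : measurable E ->
  mixing_density E omega1 -> mixing_density E omega2 ->
  (forall u, E u -> u < b -> omega1 u <= omega2 u) ->
  (forall u, E u -> b < u -> omega2 u <= omega1 u) ->
  mixture E omega1 x < mixture E omega2 x ->
  mixture E omega2 x' < mixture E omega1 x' -> x <= x'.
Proof.
move=> mE go1 go2 lb ub h h'; rewrite leNgt; apply/negP => x'x.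
have [_ _ _ io1] := go1; have [_ _ _ io2] := go2.
have : expR (b * (x' - x)) * (mixture E omega2 x - mixture E omega1 x) <=
    mixture E omega2 x' - mixture E omega1 x'.
  rewrite /mixture -!RintegralB// -RintegralZl//; last exact: integrable_EFinB.
  apply: le_Rintegral => //.
  - by apply: integrable_EFinZ => //; exact: integrable_EFinB.
  - exact: integrable_EFinB.
  - move=> u Eu; rewrite -!mulrBl mulrCA.
    have -> : expdens nu u x' = expR (u * (x' - x)) * expdens nu u x.
      rewrite /expdens -expRD; congr expR.
      by move: (logLaplace nu u) => l; ring.
    rewrite !mulrA; apply: ler_wpM2r; first exact: expR_ge0.
    (* Since [x' < x], the tilt at [u] minus the tilt at [b] changes sign at [b] in the same
       direction as [omega2 - omega1]; their product is nonnegative on both sides. *)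
    have [ub'|bu|->//] := ltgtP u b.
    + apply: ler_wpM2l; first by rewrite subr_ge0 lb.
      by rewrite ler_expR; apply: ler_wnM2r; rewrite ?subr_le0 ltW.
    + apply: ler_wnM2l; first by rewrite subr_le0 ub.
      by rewrite ler_expR; apply: ler_wnM2r; rewrite ?subr_le0 ltW.
apply/negP; rewrite -ltNge; apply: (@lt_trans _ _ 0); first by rewrite subr_lt0.
by rewrite mulr_gt0 ?expR_gt0 ?subr_gt0.
Qed.

End mixtures.

(** * Spreading the parameter away from [theta0] raises integrated perspectives *)

Section one_step_comparison.
Context {R : realType}.
Variables (nu : {sigma_finite_measure set (measurableTypeR R) -> \bar R})
  (mu : probability (measurableTypeR R) R).
Hypothesis nu_neq0 : nu [set: R] <> 0%E.
Implicit Types (E : set (measurableTypeR R)) (omega : R -> R).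

Lemma le_mixture E omega1 omega2 x : measurable E ->
  mixing_density nu mu E omega1 -> mixing_density nu mu E omega2 ->
  (forall u, E u -> omega1 u <= omega2 u) ->
  mixture nu mu E omega1 x <= mixture nu mu E omega2 x.
Proof.
move=> mE [_ _ _ io1] [_ _ _ io2] o12; apply: le_Rintegral => // u /o12 h.
by rewrite ler_wpM2r ?expR_ge0.
Qed.

(** The crossing point is the infimum of the set [D] where [omega2 < omega1]. If [D] is empty or has
    no lower bound, one density dominates the other on all of [E], which contradicts one of the two
    strict inequalities between mixtures. *)
Lemma mixture_single_crossing E omega1 omega2 x x' : measurable E ->
  mixing_density nu mu E omega1 -> mixing_density nu mu E omega2 ->
  (forall u v, E u -> E v -> u < v ->
    omega2 u < omega1 u -> omega2 v <= omega1 v) ->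
  mixture nu mu E omega1 x < mixture nu mu E omega2 x ->
  mixture nu mu E omega2 x' < mixture nu mu E omega1 x' -> x <= x'.
Proof.
move=> mE go1 go2 sc h h'.
pose D := [set u | E u /\ omega2 u < omega1 u].
have [D0|nD] := pselect (D !=set0); last first.
  exfalso; move: h'; apply/negP; rewrite -leNgt; apply: le_mixture => // u Eu.
  by rewrite leNgt; apply/negP => o21; apply: nD; exists u.
have [lD|nD] := pselect (has_lbound D); last first.
  exfalso; move: h; apply/negP; rewrite -leNgt; apply: le_mixture => // u Eu.
  have [v [Ev Dv] vu] : exists2 v, D v & v < u.
    apply: contrapT => H; apply: nD; exists u => v Dv.
    by rewrite leNgt; apply/negP => vu; apply: H; exists v.
  exact: sc Ev Eu vu Dv.
have iD : has_inf D by [].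
apply: (@mixture_crossing _ _ _ E omega1 omega2 (inf D)) h h' => //.
- move=> u Eu uD; rewrite leNgt; apply/negP => o21.
  by move: uD; apply/negP; rewrite -leNgt; apply: ge_inf.
- move=> u Eu Du; have [v [Ev Dv] vu] := inf_lt (proj1 iD) Du.
  exact: sc Ev Eu vu Dv.
Qed.

Lemma le_ratio (a b a' b' : R) : 0 < a -> 0 < b -> 0 < a' -> 0 < b' ->
  a * b' <= a' * b -> a / (a + b) <= a' / (a' + b').
Proof.
move=> a0 b0 a'0 b'0 h; rewrite ler_pdivrMr ?addr_gt0//.
rewrite mulrAC ler_pdivlMr ?addr_gt0//; nra.
Qed.

Variables (Ep Em : set (measurableTypeR R)) (theta0 : R).
Hypotheses (mEp : measurable Ep) (mEm : measurable Em).
Hypotheses (Ep_gt0 : (0 < mu Ep)%E) (Em_gt0 : (0 < mu Em)%E).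
Hypotheses (EpN : Ep `<=` natural_domain nu) (EmN : Em `<=` natural_domain nu).
Hypotheses (Ep_gt : forall u, Ep u -> theta0 < u)
  (Em_le : forall u, Em u -> u <= theta0).

(** Equal masses forbid a strict order throughout [E]. The point found on each side of [theta0]
    anchors the betweenness hypothesis when the other side is treated. *)
Lemma exists_mixing_le E omega1 omega2 : measurable E -> (0 < mu E)%E ->
  mixing_density nu mu E omega1 -> mixing_density nu mu E omega2 ->
  \int[mu]_(u in E) omega1 u = \int[mu]_(u in E) omega2 u ->
  exists2 u, E u & omega2 u <= omega1 u.
Proof.
move=> mE E0 [_ _ io1 _] [_ _ io2 _] I12; apply: contrapT => H.
have : 0 < \int[mu]_(u in E) (omega2 u - omega1 u).
  apply: Rintegral_gt0 => //; first exact: integrable_EFinB.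
  move=> u Eu; rewrite subr_gt0 ltNge; apply/negP => h; apply: H; by exists u.
by rewrite RintegralB// I12 subrr ltxx.
Qed.

(* [omega2] spreads mass away from [theta0] on both sides, which makes the two
   hypotheses easier to tell apart. The two sides are moved one at a time. *)
Lemma spread_perspective_le (F : R -> R) M omega1 omega2 :
  convex01 F -> (forall r, 0 < r < 1 -> `|F r| <= M) ->
  mixing_density nu mu Ep omega1 -> mixing_density nu mu Ep omega2 ->
  mixing_density nu mu Em omega1 -> mixing_density nu mu Em omega2 ->
  \int[mu]_(u in Ep) omega1 u = \int[mu]_(u in Ep) omega2 u ->
  \int[mu]_(u in Em) omega1 u = \int[mu]_(u in Em) omega2 u ->
  (forall u v w, natural_domain nu u -> natural_domain nu w ->
    u < v -> v < w -> omega2 u <= omega1 u -> omega2 w <= omega1 w ->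
    omega2 v <= omega1 v) ->
  \int[nu]_x perspective F (mixture nu mu Ep omega1 x)
                           (mixture nu mu Em omega1 x) <=
  \int[nu]_x perspective F (mixture nu mu Ep omega2 x)
                           (mixture nu mu Em omega2 x).
Proof.
move=> cF bF gp1 gp2 gm1 gm2 Ip Im qc.
have [vp Epvp ovp] := exists_mixing_le mEp Ep_gt0 gp1 gp2 Ip.
have [vm Emvm ovm] := exists_mixing_le mEm Em_gt0 gm1 gm2 Im.
have p1 x : 0 < mixture nu mu Ep omega1 x by exact: mixture_gt0.
have p2 x : 0 < mixture nu mu Ep omega2 x by exact: mixture_gt0.
have n1 x : 0 < mixture nu mu Em omega1 x by exact: mixture_gt0.
have n2 x : 0 < mixture nu mu Em omega2 x by exact: mixture_gt0.
have ip1 := integrable_mixture nu_neq0 mEp EpN gp1.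
have ip2 := integrable_mixture nu_neq0 mEp EpN gp2.
have im1 := integrable_mixture nu_neq0 mEm EmN gm1.
have im2 := integrable_mixture nu_neq0 mEm EmN gm2.
have EpW u : Ep u -> theta0 <= u by move=> /Ep_gt/ltW.
apply: (@le_trans _ _ (\int[nu]_x perspective F (mixture nu mu Ep omega1 x)
                           (mixture nu mu Em omega2 x))).
- apply: (@perspective_integral_le R _ (measurableTypeR R) nu F M cF bF
    _ _ _ p1 n1 n2 ip1 im1 im2).
    by rewrite !RintegralT_mixture.
  move=> x x' h h'; apply: (le_ratio (p1 x) (n1 x) (p1 x') (n1 x')).
  apply: (mixture_ratio mEp mEm gp1 gm1 EpW Em_le).
  (* For [u < v] in [Em], the point [v] lies between [u] and the anchor [vp] across [theta0], so
     [omega2 <= omega1] passes from [u] to [v]. *)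
  apply: mixture_single_crossing mEm gm1 gm2 _ h h' => u v Eu Ev uv /ltW o21.
  apply: (@qc u v vp) => //; [exact: EmN|exact: EpN|].
  by rewrite (le_lt_trans (Em_le Ev))// Ep_gt.
- have sw (f g : R -> R) : (forall x, 0 < f x) -> (forall x, 0 < g x) ->
      \int[nu]_x perspective F (f x) (g x) =
      \int[nu]_x perspective (fun r => F (1 - r)) (g x) (f x).
    by move=> f0 g0; apply: eq_Rintegral => x _; rewrite perspective_swap.
  rewrite (sw _ _ p1 n2) (sw _ _ p2 n2).
  have bF' r : 0 < r < 1 -> `|F (1 - r)| <= M by move=> r01; apply: bF; lra.
  apply: (@perspective_integral_le R _ (measurableTypeR R) nu _ M
    (convex01_swap cF) bF' _ _ _ n2 p1 p2 im2 ip1 ip2).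
    by rewrite !RintegralT_mixture.
  move=> x x' h h'; apply: (le_ratio (n2 x) (p1 x) (n2 x') (p1 x')).
  rewrite mulrC [leRHS]mulrC.
  apply: (mixture_ratio mEp mEm gp1 gm2 EpW Em_le).
  (* On [Ep] the crossing is reversed: the anchor [vm] lies to the left, so [omega2 v < omega1 v]
     would force [omega2 u <= omega1 u] at the intermediate point [u]. *)
  apply: mixture_single_crossing mEp gp2 gp1 _ h' h => u v Eu Ev uv o12.
  rewrite leNgt; apply/negP => o21.
  move: o12; apply/negP; rewrite -leNgt.
  apply: (@qc vm u v) => //; [exact: EmN|exact: EpN| |exact: ltW].
  by rewrite (le_lt_trans (Em_le Emvm))// Ep_gt.
Qed.

End one_step_comparison.

(** * The posterior probability is a continuous increasing bijection of the sum *)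

Section posterior_level.
Context {R : realType}.
Variables (nu : {sigma_finite_measure set (measurableTypeR R) -> \bar R})
  (mu : probability (measurableTypeR R) R) (theta0 : R).
Hypothesis mu_concentrated : mu (natural_domain nu)° = 1%E.
Hypothesis mu_plus : (0 < mu (supp_plus mu theta0) < 1)%E.
Hypothesis weight_fin : forall (n : nat) (y : R),
  (\int[mu]_(u in msupport mu) (weight nu n y u)%:E < +oo)%E.
Local Notation Kp := (carrier_plus nu mu theta0).
Local Notation Km := (carrier_minus nu mu theta0).
Local Notation q := (post_prob nu mu theta0).
Local Notation mass := (mass nu mu).

Let mKp : measurable Kp := measurable_carrier_plus nu mu theta0.
Let mKm : measurable Km := measurable_carrier_minus nu mu theta0.
Let iKp n y : mu.-integrable Kp (EFin \o weight nu n y) :=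
  integrable_weight weight_fin n y mKp (@carrier_plus_sub _ nu mu theta0).
Let iKm n y : mu.-integrable Km (EFin \o weight nu n y) :=
  integrable_weight weight_fin n y mKm (@carrier_minus_sub _ nu mu theta0).
Let Mp0 n y : 0 < mass Kp n y := mass_plus_gt0 mu_concentrated mu_plus weight_fin n y.
Let Mm0 n y : 0 < mass Km n y := mass_minus_gt0 mu_concentrated mu_plus weight_fin n y.

Lemma weight_shift n y z u :
  weight nu n (y + z) u = expR (u * z) * weight nu n y u.
Proof.
by rewrite /weight -expRD; congr expR; move: (logLaplace nu u) => l; ring.
Qed.

Lemma weight_shiftB n y z u :
  weight nu n z u = expR (u * (z - y)) * weight nu n y u.
Proof. by rewrite -weight_shift addrC subrK. Qed.

Lemma post_prob_le n y p : p < 1 ->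
  (q n y <= p) = (mass Kp n y * (1 - p) <= mass Km n y * p).
Proof.
move=> p1; rewrite post_probE// ler_pdivrMr ?addr_gt0//.
move: (mass Kp n y) (mass Km n y) => a b; apply/idP/idP; lra.
Qed.

(** The tilt at [theta0] is the common yardstick below: left of [theta0] a shift by [z >= 0] gains
    at most this factor, right of it strictly more when [z > 0]. *)
Lemma mass_minus_shift n y z : 0 <= z ->
  mass Km n (y + z) <= expR (theta0 * z) * mass Km n y.
Proof.
move=> z0; rewrite /mass -RintegralZl//; apply: le_Rintegral => //.
  exact: integrable_EFinZ.
move=> u [_ /= u0]; rewrite weight_shift ler_wpM2r ?(ltW (weight_gt0 _ _ _ _))//.
by rewrite ler_expR ler_wpM2r.
Qed.

Lemma post_prob_lt n y y' : y < y' -> q n y < q n y'.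
Proof.
move=> yy'; have z0 : 0 < y' - y by rewrite subr_gt0.
have Hp : expR (theta0 * (y' - y)) * mass Kp n y < mass Kp n y'.
  rewrite -subr_gt0 /mass -RintegralZl// -RintegralB//; last first.
    exact: integrable_EFinZ.
  apply: Rintegral_gt0 => //.
  - by apply: integrable_EFinB => //; exact: integrable_EFinZ.
  - move=> u [_ /= u0]; rewrite subr_gt0 (weight_shiftB n y y').
    by rewrite ltr_pM2r ?weight_gt0// ltr_expR ltr_pM2r.
  - exact: mu_carrier_plus.
have Hm : mass Km n y' <= expR (theta0 * (y' - y)) * mass Km n y.
  by have := mass_minus_shift n y (ltW z0); rewrite addrC subrK.
have e0 := expR_gt0 (theta0 * (y' - y)).
rewrite !post_probE//.
move: (Mp0 n y) (Mm0 n y) (Mp0 n y') (Mm0 n y') Hp Hm e0.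
move: (mass Kp n y) (mass Km n y) (mass Kp n y') (mass Km n y') (expR _).
move=> a b a' b' e a0 b0 a'0 b'0 Hp Hm e0.
rewrite ltr_pdivrMr ?addr_gt0// mulrAC ltr_pdivlMr ?addr_gt0//.
suff : a * b' < a' * b by lra.
apply: (@le_lt_trans _ _ (e * a * b)); last by rewrite ltr_pM2r.
by rewrite mulrAC mulrC ler_pM2r.
Qed.

Lemma post_prob_inj n : injective (q n).
Proof.
move=> y y' /eqP; have [/(post_prob_lt n)|/(post_prob_lt n)|//] := ltgtP y y'.
  by move=> /lt_eqF->.
by move=> /gt_eqF->.
Qed.

Lemma post_prob_mono n y y' : (q n y <= q n y') = (y <= y').
Proof.
have [h|h|->] := ltgtP y y'; last by rewrite lexx.
  by rewrite ltW// post_prob_lt.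
by rewrite leNgt post_prob_lt.
Qed.

Lemma continuous_mass (E : set (measurableTypeR R)) n : measurable E ->
  E `<=` carrier nu mu -> continuous (mass E n).
Proof.
move=> mE EK a.
have iE y := integrable_weight weight_fin n y mE EK.
have := @continuity_under_integral R _ (measurableTypeR R) mu
  (weight nu n) E mE (a - 1) (a + 1) (fun x _ => iE x) _
  (* The weight is monotone in [y], in a direction given by the sign of [u]; the sum of its values
     at both ends dominates it on the whole interval. *)
  (fun u => weight nu n (a + 1) u + weight nu n (a - 1) u) _ _ a.
apply.
- apply: aeW => u _ y _; apply: continuous_comp; last exact: continuous_expR.
  apply: (@cvgB _ _ R^o); last exact: cvg_cst.
  by apply: cvgM; [exact: cvg_cst|exact: cvg_id].
- exact: integrable_EFinD.
- move=> y /= /[!in_itv]/= /andP[y1 y2]; apply: aeW => u _.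
  rewrite gtr0_norm ?weight_gt0// (weight_shiftB n a y) !weight_shift -mulrDl.
  rewrite ler_wpM2r ?(ltW (weight_gt0 _ _ _ _))//.
  have [u0|u0] := leP 0 u.
    by apply: ler_wpDr; rewrite ?expR_ge0// ler_expR; nra.
  by apply: ler_wpDl; rewrite ?expR_ge0// ler_expR; nra.
- by rewrite inE/= in_itv/=; lra.
Qed.

Lemma continuous_post_prob n : continuous (q n).
Proof.
rewrite (_ : q n = (fun y => mass Kp n y / (mass Kp n y + mass Km n y))); last first.
  by apply/funext => y; rewrite post_probE.
move=> y; apply: (@cvgM R R); first exact: continuous_mass (@carrier_plus_sub _ _ _ _) _.
apply: cvgV; first by rewrite gt_eqF// addr_gt0.
by apply: (@cvgD _ R^o); apply: continuous_mass => //;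
  [exact: carrier_plus_sub|exact: carrier_minus_sub].
Qed.

(** At [y = - k], after multiplication by [expR (theta0 * k)], the right mass tends to 0 by
    dominated convergence, its integrand carrying the factor [expR (theta0 - u) ^+ k], while the
    left mass stays at least [mass Km n 0]. *)
Lemma post_prob_ub n p : 0 < p < 1 -> exists y, q n y <= p.
Proof.
move=> /andP[p0 p1].
have : \int[mu]_(u in Kp) (weight nu n (- k%:R) u * expR (theta0 * k%:R))
    @[k --> \oo] --> (0 : R).
  have [|||||_ _ H] := @dominated_convergence _ (measurableTypeR R) R mu Kp mKp
    (fun k u => (weight nu n (- k%:R) u * expR (theta0 * k%:R))%:E) (cst 0%E)
    (EFin \o weight nu n 0).
  - move=> k; apply/measurable_EFinP; apply: measurable_funM => //.
    by apply: measurable_funTS; exact: measurable_weight.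
  - by [].
  - apply: aeW => u [_ /= u0].
    have -> : (fun k => (weight nu n (- k%:R) u * expR (theta0 * k%:R))%:E) =
        (fun k => (expR (theta0 - u) ^+ k * weight nu n 0 u)%:E).
      apply/funext => k; rewrite (weight_shiftB n 0 (- k%:R)) mulrAC.
      by rewrite -expRD -expRM_natl; congr ((expR _ * _)%:E); ring.
    apply: cvg_EFin; first by exists 0%N.
    have H : GRing.exp (expR (theta0 - u)) @ \oo --> (0 : R).
      by apply: cvg_expr; rewrite gtr0_norm ?expR_gt0// expR_lt1 subr_lt0.
    move: (weight nu n 0 u) => w.
    by rewrite -[X in _ --> X](mul0r w); apply: (cvgM H (cvg_cst w)).
  - exact: iKp.
  - apply: aeW => u k [_ /= u0].
    rewrite lee_fin ger0_norm ?mulr_ge0 ?expR_ge0 ?(ltW (weight_gt0 _ _ _ _))//.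
    rewrite (weight_shiftB n 0 (- k%:R)) mulrAC -expRD.
    rewrite ger_pMl ?weight_gt0// expR_le1 subr0 mulrN addrC -mulrBl.
    by rewrite mulr_le0_ge0// subr_le0 ltW.
  move: H; rewrite integral0 => H.
  by apply: fine_cvg; exact: H.
move=> /cvgrPdist_lt /(_ (mass Km n 0 * p / (1 - p))) [].
  by rewrite divr_gt0 ?mulr_gt0 ?subr_gt0.
move=> k _ /(_ k (leqnn k)); rewrite sub0r normrN => H.
exists (- k%:R); rewrite post_prob_le//.
have {}H : expR (theta0 * k%:R) * mass Kp n (- k%:R) < mass Km n 0 * p / (1 - p).
  apply: le_lt_trans H; rewrite -RintegralZl//.
  by under eq_Rintegral do rewrite mulrC; exact: ler_norm.
have := mass_minus_shift n (- k%:R) (ler0n R k); rewrite addNr => Hm.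
move: H; rewrite ltr_pdivlMr ?subr_gt0// => H.
rewrite -(ler_pM2l (expR_gt0 (theta0 * k%:R))).
move: (expR _) Hm H => e Hm H.
by rewrite !mulrA (le_trans (ltW H))// ler_pM2r.
Qed.

Lemma post_prob_lb n p : 0 < p < 1 -> exists y, p <= q n y.
Proof.
move=> /andP[p0 p1].
(* The bound [t <= expR t] at [t = u - theta0] dominates the integrand by a multiple of the weight
   at sum 1. *)
have mJ : mu.-integrable Kp (EFin \o (fun u => (u - theta0) * weight nu n 0 u)).
  apply: (@le_integrable_EFin _ _ (measurableTypeR R) mu Kp
      (fun u => (u - theta0) * weight nu n 0 u)
      (fun u => expR (- theta0) * weight nu n 1 u)) => //.
  - apply: measurable_funTS; apply: measurable_funM; first exact: measurable_funB.
    exact: measurable_weight.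
  - move=> u [_ /= u0]; rewrite ger0_norm; last first.
      by rewrite mulr_ge0 ?subr_ge0 ?(ltW (weight_gt0 _ _ _ _))// ltW.
    rewrite (weight_shiftB n 0 1) subr0 mulrA ler_wpM2r ?(ltW (weight_gt0 _ _ _ _))//.
    by rewrite -expRD mulr1 addrC (le_trans _ (expR_ge1Dx _))// lerDr.
  - exact: integrable_EFinZ.
set J := \int[mu]_(u in Kp) ((u - theta0) * weight nu n 0 u).
have J0 : 0 < J.
  apply: Rintegral_gt0 => //; last exact: mu_carrier_plus.
  by move=> u [_ /= u0]; rewrite mulr_gt0 ?weight_gt0 ?subr_gt0.
(* The right mass relative to the tilt at [theta0] grows at least like [y * J], the left one stays
   below [mass Km n 0]; this [y] balances the two bounds at odds [p] to [1 - p]. *)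
have [y [y0 yE]] : exists y, 0 < y /\ y * J * (1 - p) = mass Km n 0 * p.
  exists (mass Km n 0 * p / (1 - p) / J).
  rewrite !divr_gt0 ?mulr_gt0 ?subr_gt0//; split => //.
  by rewrite mulfVK ?gt_eqF// mulfVK// subr_eq0 eq_sym lt_eqF.
have Hm := mass_minus_shift n 0 (ltW y0); rewrite add0r in Hm.
have Hp : expR (theta0 * y) * (y * J) <= mass Kp n y.
  rewrite /J -!RintegralZl//; last exact: integrable_EFinZ.
  apply: le_Rintegral => //.
    by apply: integrable_EFinZ => //; exact: integrable_EFinZ.
  move=> u [_ /= u0]; rewrite (weight_shiftB n 0 y) subr0.
  rewrite !mulrA ler_wpM2r ?(ltW (weight_gt0 _ _ _ _))//.
  have -> : u * y = theta0 * y + (u - theta0) * y by ring.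
  rewrite expRD -mulrA ler_wpM2l ?expR_ge0//.
  by rewrite mulrC (le_trans _ (expR_ge1Dx _))// lerDr.
exists y; rewrite post_probE// ler_pdivlMr ?addr_gt0//.
suff : mass Km n y * p <= mass Kp n y * (1 - p).
  by move: (mass Km n y) (mass Kp n y) => a b; lra.
apply: (le_trans (ler_wpM2r (ltW p0) Hm)).
rewrite -mulrA -yE mulrA.
by rewrite ler_wpM2r// subr_ge0 ltW.
Qed.

Lemma post_prob_level n p : 0 < p < 1 -> q n (level nu mu theta0 n p) = p.
Proof.
move=> p01; have [a pa] := post_prob_ub n p01; have [b pb] := post_prob_lb n p01.
have ab : a <= b by rewrite -(post_prob_mono n) (le_trans pa).
have [||c _ cp] := @IVT R (q n) a b p ab.
- by apply: continuous_subspaceT => x; exact: continuous_post_prob.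
- apply/andP; split; first by rewrite ge_min; apply/orP; left; exact: pa.
  by rewrite le_max; apply/orP; right; exact: pb.
- exact: (@xgetPex _ 0 [set y | q n y = p] (ex_intro _ c cp)).
Qed.

Lemma level_post_prob n y : level nu mu theta0 n (q n y) = y.
Proof.
by apply: (@post_prob_inj n); rewrite post_prob_level// post_prob01.
Qed.

End posterior_level.

(** * One observation: monotonicity in time and convexity in the posterior probability *)

Section one_step_posterior.
Context {R : realType}.
Variables (nu : {sigma_finite_measure set (measurableTypeR R) -> \bar R})
  (mu : probability (measurableTypeR R) R) (theta0 : R).
Hypothesis nu_neq0 : nu [set: R] <> 0%E.
Hypothesis mu_concentrated : mu (natural_domain nu)° = 1%E.
Hypothesis mu_plus : (0 < mu (supp_plus mu theta0) < 1)%E.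
Hypothesis weight_fin : forall (n : nat) (y : R),
  (\int[mu]_(u in msupport mu) (weight nu n y u)%:E < +oo)%E.
Local Notation K := (carrier nu mu).
Local Notation Kp := (carrier_plus nu mu theta0).
Local Notation Km := (carrier_minus nu mu theta0).
Local Notation q := (post_prob nu mu theta0).
Local Notation mass := (mass nu mu).
Local Notation density := (post_density nu mu).
Local Notation mix := (mixture nu mu).
Local Notation level := (level nu mu theta0).

Let mK : measurable K.
Proof. exact: measurable_carrier nu mu. Qed.
Let mKp : measurable Kp.
Proof. exact: measurable_carrier_plus nu mu theta0. Qed.
Let mKm : measurable Km.
Proof. exact: measurable_carrier_minus nu mu theta0. Qed.
Let Mp0 n y : 0 < mass Kp n y.
Proof. exact: mass_plus_gt0 mu_concentrated mu_plus weight_fin n y. Qed.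
Let Mm0 n y : 0 < mass Km n y.
Proof. exact: mass_minus_gt0 mu_concentrated mu_plus weight_fin n y. Qed.
Let M0 n y : 0 < mass K n y.
Proof. exact: mass_carrier_gt0 mu_concentrated mu_plus weight_fin n y. Qed.
Let KpK : Kp `<=` K.
Proof. exact: @carrier_plus_sub _ nu mu theta0. Qed.
Let KmK : Km `<=` K.
Proof. exact: @carrier_minus_sub _ nu mu theta0. Qed.
Let KpN : Kp `<=` natural_domain nu.
Proof. by move=> u /KpK/carrier_natural_domain. Qed.
Let KmN : Km `<=` natural_domain nu.
Proof. by move=> u /KmK/carrier_natural_domain. Qed.
Lemma post_densityE n y u : density n y u = (mass K n y)^-1 * weight nu n y u.
Proof. by rewrite /post_density integral_weight_msupport// mulrC. Qed.

Lemma post_density_gt0 n y u : 0 < density n y u.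
Proof. by rewrite post_densityE mulr_gt0 ?invr_gt0 ?weight_gt0. Qed.

Lemma measurable_post_density n y :
  measurable_fun [set: measurableTypeR R] (density n y).
Proof. by apply: measurable_funM => //; exact: measurable_weight. Qed.

Lemma post_density_expdens n y x u :
  density n y u * expdens nu u x = (mass K n y)^-1 * weight nu n.+1 (y + x) u.
Proof. by rewrite post_densityE -mulrA weight_expdens. Qed.

Lemma post_density_mixing (E : set (measurableTypeR R)) n y :
  measurable E -> E `<=` K -> mixing_density nu mu E (density n y).
Proof.
move=> mE EK; split.
- exact: measurable_post_density.
- exact: post_density_gt0.
- rewrite (_ : density n y = fun u => (mass K n y)^-1 * weight nu n y u).
    by apply: integrable_EFinZ => //; exact: integrable_weight.
  by apply/funext => u; rewrite post_densityE.
- move=> x; under eq_fun do rewrite post_density_expdens.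
  by apply: integrable_EFinZ => //; exact: integrable_weight.
Qed.

Lemma mixture_post_density (E : set (measurableTypeR R)) n y x :
  measurable E -> E `<=` K ->
  mix E (density n y) x = mass E n.+1 (y + x) / mass K n y.
Proof.
move=> mE EK; rewrite /mixture; under eq_Rintegral do rewrite post_density_expdens.
rewrite RintegralZl//; first by rewrite mulrC.
exact: integrable_weight.
Qed.

Lemma mixture_carrier n y x :
  mix K (density n y) x = mix Kp (density n y) x + mix Km (density n y) x.
Proof. by rewrite !mixture_post_density// (mass_carrier theta0 weight_fin) mulrDl. Qed.

(** Both mixtures are masses at the updated state over the same normaliser, which cancels. *)
Lemma mixture_post_prob n y x :
  mix Kp (density n y) x /
    (mix Kp (density n y) x + mix Km (density n y) x) = q n.+1 (y + x).
Proof.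
rewrite !mixture_post_density// -mulrDl post_probE//.
move: (M0 n y) (Mp0 n.+1 (y + x)) (Mm0 n.+1 (y + x)).
move: (mass K n y) (mass Kp _ _) (mass Km _ _) => a b c a0 b0 c0.
by field; rewrite !gt_eqF ?addr_gt0.
Qed.

Lemma post_density_plus n y : \int[mu]_(u in Kp) density n y u = q n y.
Proof.
under eq_Rintegral do rewrite post_densityE.
rewrite RintegralZl//; last exact: integrable_weight.
by rewrite post_probE// (mass_carrier theta0 weight_fin) mulrC.
Qed.

Lemma post_density_minus n y : \int[mu]_(u in Km) density n y u = 1 - q n y.
Proof.
under eq_Rintegral do rewrite post_densityE.
rewrite RintegralZl//; last exact: integrable_weight.
rewrite post_probE// (mass_carrier theta0 weight_fin) mulrC -/(mass Km n y).
move: (Mp0 n y) (Mm0 n y); move: (mass Kp n y) (mass Km n y) => a b a0 b0.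
by field; rewrite gt_eqF ?addr_gt0.
Qed.

(* Expected value of [F] at the posterior probability one observation after
   state [(n, y)]. *)
Definition one_step F n y :=
  \int[nu]_x perspective F (mix Kp (density n y) x) (mix Km (density n y) x).

Lemma perspective_mixture (F : R -> R) n y x :
  perspective F (mix Kp (density n y) x) (mix Km (density n y) x) =
  mix K (density n y) x * F (q n.+1 (y + x)).
Proof. by rewrite /perspective mixture_post_prob mixture_carrier. Qed.

Let Kp_gt u : Kp u -> theta0 < u. Proof. by case. Qed.
Let Km_le u : Km u -> u <= theta0. Proof. by case. Qed.
Let mu_Kp : (0 < mu Kp)%E.
Proof. exact: mu_carrier_plus mu_concentrated mu_plus. Qed.
Let mu_Km : (0 < mu Km)%E.
Proof. exact: mu_carrier_minus mu_concentrated mu_plus. Qed.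

Lemma mixing_density_lincomb (E : set (measurableTypeR R)) t om om' :
  measurable E -> 0 <= t <= 1 ->
  mixing_density nu mu E om -> mixing_density nu mu E om' ->
  mixing_density nu mu E (fun u => t * om u + (1 - t) * om' u).
Proof.
move=> mE /andP[t0 t1] [mo o0 io iox] [mo' o'0 io' iox']; split.
- by apply: measurable_funD; apply: measurable_funM.
- move=> u; have := o0 u; have := o'0 u; nra.
- by apply: integrable_EFinD => //; apply: integrable_EFinZ.
- move=> x; under eq_fun do rewrite mulrDl -!mulrA.
  by apply: integrable_EFinD => //; apply: integrable_EFinZ.
Qed.

Lemma mixture_lincomb (E : set (measurableTypeR R)) t om om' x :
  measurable E -> mixing_density nu mu E om -> mixing_density nu mu E om' ->
  mix E (fun u => t * om u + (1 - t) * om' u) x =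
  t * mix E om x + (1 - t) * mix E om' x.
Proof.
move=> mE [mo o0 io iox] [mo' o'0 io' iox'].
rewrite /mixture; under eq_Rintegral do rewrite mulrDl -!mulrA.
rewrite RintegralD//.
- by rewrite !RintegralZl.
- exact: integrable_EFinZ mE (iox x).
- exact: integrable_EFinZ mE (iox' x).
Qed.

(** Reduces the betweenness hypothesis of [spread_perspective_le] to a convexity argument about one
    explicit function [phi]. *)
Lemma le_between_of_sign (P : set R) (f g phi : R -> R) :
  (forall s, (f s <= g s) = (phi s <= 0)) ->
  (forall u v w, P u -> P w -> u < v -> v < w ->
    phi u <= 0 -> phi w <= 0 -> phi v <= 0) ->
  forall u v w, P u -> P w -> u < v -> v < w ->
    f u <= g u -> f w <= g w -> f v <= g v.
Proof.
by move=> fg H u v w Pu Pw uv vw; rewrite !fg; exact: H.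
Qed.

Lemma expR_affine_between (c al u v w : R) : u < v -> v < w -> 0 <= c ->
  (w - u) * (c * expR (v * al)) <=
  (w - v) * (c * expR (u * al)) + (v - u) * (c * expR (w * al)).
Proof.
move=> uv vw c0.
have wu : 0 < w - u by lra.
have t0 : 0 <= (w - v) / (w - u) by rewrite divr_ge0//; lra.
have t1 : (w - v) / (w - u) <= 1 by rewrite ler_pdivrMr//; lra.
have := convex_expR (Itv01 t0 t1) (u * al) (w * al).
rewrite !convRE /= /unstable.onem.
have -> : (w - v) / (w - u) * (u * al) + (1 - (w - v) / (w - u)) * (w * al) =
  v * al by field; lra.
move: (expR _) (expR _) (expR _) => d b a h.
have {}h : (w - u) * a <= (w - v) * b + (v - u) * d.
  have -> : (w - v) * b + (v - u) * d =
    (w - u) * ((w - v) / (w - u) * b + (1 - (w - v) / (w - u)) * d).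
    by field; lra.
  by rewrite ler_pM2l.
by have := ler_wpM2l c0 h; lra.
Qed.

Lemma le_of_convex_comb (D a b c u v w : R) : u < v -> v < w ->
  (w - u) * b <= (w - v) * a + (v - u) * c -> a <= D -> c <= D -> b <= D.
Proof.
move=> uv vw h aD cD; have wu : 0 < w - u by lra.
rewrite -(ler_pM2l wu); nra.
Qed.

Lemma between_convex_comb (u v w : R) : u < v -> v < w ->
  0 <= (w - v) / (w - u) <= 1 /\
  (w - v) / (w - u) * u + (1 - (w - v) / (w - u)) * w = v.
Proof.
move=> uv vw; split; last by field; lra.
by rewrite divr_ge0 ?ler_pdivrMr//=; lra.
Qed.

(** The log-ratio is affine in the parameter plus [(k2 - k1)] times the log-Laplace transform. It is
    convex because [k1 <= k2], so it stays nonpositive between two points where it is; the order of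
    the two times enters here. *)
Lemma log_ratio_between (y z k1 k2 c1 c2 bu bv bw u v w : R) :
  u < v -> v < w -> k1 <= k2 ->
  bv <= (w - v) / (w - u) * bu + (1 - (w - v) / (w - u)) * bw ->
  u * y - k1 * bu - c1 - (u * z - k2 * bu - c2) <= 0 ->
  w * y - k1 * bw - c1 - (w * z - k2 * bw - c2) <= 0 ->
  v * y - k1 * bv - c1 - (v * z - k2 * bv - c2) <= 0.
Proof.
move=> uv vw; have [] := between_convex_comb uv vw.
set t := (w - v) / (w - u); move=> /andP[t0 t1] e k12 bvP hu hw.
have H : (k2 - k1) * bv <= (k2 - k1) * (t * bu + (1 - t) * bw).
  by rewrite ler_wpM2l// subr_ge0.
rewrite -e; nra.
Qed.

Lemma expR_lincomb_between (c c' al al' u v w : R) : u < v -> v < w ->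
  0 <= c -> 0 <= c' ->
  (w - u) * (c * expR (v * al) + c' * expR (v * al')) <=
  (w - v) * (c * expR (u * al) + c' * expR (u * al')) +
  (v - u) * (c * expR (w * al) + c' * expR (w * al')).
Proof.
move=> uv vw c0 c'0.
have := expR_affine_between al uv vw c0.
have := expR_affine_between al' uv vw c'0; lra.
Qed.

Lemma integrable_one_step (F : R -> R) (M : R) n y :
  convex01 F -> (forall r, 0 < r < 1 -> `|F r| <= M) ->
  nu.-integrable setT (EFin \o (fun x =>
    perspective F (mix Kp (density n y) x) (mix Km (density n y) x))).
Proof.
move=> cF bF.
apply: (@integrable_perspective R _ (measurableTypeR R) nu F M cF bF).
- by move=> x; apply: mixture_gt0 => //; exact: post_density_mixing.
- by move=> x; apply: mixture_gt0 => //; exact: post_density_mixing.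
- by apply: integrable_mixture => //; exact: post_density_mixing.
- by apply: integrable_mixture => //; exact: post_density_mixing.
Qed.

#[local] Opaque post_density mixture.

(* [ln] of the ratio of the two densities is convex because [logLaplace] is. *)
Lemma one_step_antitone (F : R -> R) (M : R) m n y z :
  convex01 F -> (forall r, 0 < r < 1 -> `|F r| <= M) ->
  (m <= n)%N -> q m y = q n z -> one_step F n z <= one_step F m y.
Proof.
move=> cF bF mn qq; apply: (spread_perspective_le nu_neq0 mKp mKm mu_Kp mu_Km
  KpN KmN Kp_gt Km_le cF bF); try exact: post_density_mixing.
- exact: etrans (post_density_plus n z)
    (etrans (esym qq) (esym (post_density_plus m y))).
- by rewrite (post_density_minus n z) -qq; exact: esym (post_density_minus m y).
have lnM k x : expR (- ln (mass K k x)) = (mass K k x)^-1.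
  by rewrite expRN lnK// posrE.
have dE k x s : density k x s =
    expR (s * x - k%:R * logLaplace nu s - ln (mass K k x)).
  by rewrite post_densityE [RHS]expRD lnM mulrC.
have cmp s : (density m y s <= density n z s) =
    ((fun s => s * y - m%:R * logLaplace nu s - ln (mass K m y) -
     (s * z - n%:R * logLaplace nu s - ln (mass K n z))) s <= 0).
  by rewrite (dE m y) (dE n z) ler_expR subr_le0.
apply: (le_between_of_sign cmp) => u v w Nu Nw uv vw.
have [t01 e] := between_convex_comb uv vw.
have [_] := logLaplace_convex nu_neq0 Nu Nw t01; rewrite e => bv hu hw.
have kn : m%:R <= n%:R :> R by rewrite ler_nat.
exact: log_ratio_between uv vw kn bv hu hw.
Qed.

(* The prior at [t * a + (1 - t) * b] is compared with the mixture of the priors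
   at [a] and [b]; revealing which of the two was drawn only helps. *)
Lemma one_step_convex (F : R -> R) (M : R) n :
  convex01 F -> (forall r, 0 < r < 1 -> `|F r| <= M) ->
  convex01 (fun p => one_step F n (level n p)).
Proof.
move=> cF bF a b t a01 b01 t01.
pose p := t * a + (1 - t) * b.
have p01 : 0 < p < 1 by exact: conv01.
have [y [yE qy]] : exists y, level n p = y /\ q n y = p.
  by exists (level n p); rewrite post_prob_level.
have [ya [yaE qya]] : exists y, level n a = y /\ q n y = a.
  by exists (level n a); rewrite post_prob_level.
have [yb [ybE qyb]] : exists y, level n b = y /\ q n y = b.
  by exists (level n b); rewrite post_prob_level.
rewrite -/p yE yaE ybE => {yE yaE ybE}.
pose om2 u := t * density n ya u + (1 - t) * density n yb u.
have gp := post_density_mixing n _ mKp KpK.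
have gm := post_density_mixing n _ mKm KmK.
apply: (@le_trans _ _ (\int[nu]_x perspective F (mix Kp om2 x) (mix Km om2 x))).
  have op := mixing_density_lincomb mKp t01 (gp ya) (gp yb).
  have om := mixing_density_lincomb mKm t01 (gm ya) (gm yb).
  apply: (spread_perspective_le nu_neq0 mKp mKm mu_Kp mu_Km
    KpN KmN Kp_gt Km_le cF bF (gp y) op (gm y) om).
  - rewrite /om2 RintegralD//; last 2 first.
    + by apply: integrable_EFinZ => //; case: (gp ya).
    + by apply: integrable_EFinZ => //; case: (gp yb).
    rewrite !RintegralZl//; last 2 first.
    + by case: (gp yb).
    + by case: (gp ya).
    apply: (etrans (etrans (post_density_plus n y) qy)).
    congr (t * _ + (1 - t) * _).
      exact: esym (etrans (post_density_plus n ya) qya).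
    exact: esym (etrans (post_density_plus n yb) qyb).
  - rewrite /om2 RintegralD//; last 2 first.
    + by apply: integrable_EFinZ => //; case: (gm ya).
    + by apply: integrable_EFinZ => //; case: (gm yb).
    rewrite !RintegralZl//; last 2 first.
    + by case: (gm yb).
    + by case: (gm ya).
    apply: (etrans (post_density_minus n y)); rewrite qy.
    transitivity (t * (1 - a) + (1 - t) * (1 - b)); first by rewrite /p; ring.
    congr (t * _ + (1 - t) * _).
      by rewrite -qya; exact: esym (post_density_minus n ya).
    by rewrite -qyb; exact: esym (post_density_minus n yb).
  (* Divided by [weight nu n y s], the left side becomes a nonnegative combination of exponentials
     of [s], hence convex, and the right side a constant. *)
  - have cmp s : (om2 s <= density n y s) =
        ((fun s => t * ((mass K n ya)^-1 * expR (s * (ya - y))) +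
         (1 - t) * ((mass K n yb)^-1 * expR (s * (yb - y))) -
         (mass K n y)^-1) s <= 0).
      have e0 := weight_gt0 nu n y s.
      rewrite /om2 (post_densityE n ya) (post_densityE n yb) (post_densityE n y).
      rewrite (weight_shiftB _ n y ya) (weight_shiftB _ n y yb).
      rewrite subr_le0 -[in RHS](ler_pM2r e0).
      generalize (mass K n ya)^-1 (mass K n yb)^-1 (mass K n y)^-1.
      generalize (expR (s * (ya - y))) (expR (s * (yb - y))) => x1 x2 d1 d2 d3.
      by move: (weight nu n y s) => e; congr (_ <= _); ring.
    apply: (le_between_of_sign cmp) => u v w _ _ uv vw /=.
    rewrite !subr_le0 !mulrA.
    case/andP: t01 => t0 t1.
    apply: (le_of_convex_comb uv vw); apply: expR_lincomb_between uv vw _ _.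
      by rewrite divr_ge0// ltW.
    by rewrite divr_ge0 ?subr_ge0// ltW.
(* For the mixed posterior, both predictive densities are the same convex combinations, so joint
   convexity of the perspective applies at each [x]. *)
rewrite /one_step -!RintegralZl//; last 2 first.
- exact: integrable_one_step cF bF.
- exact: integrable_one_step cF bF.
rewrite -RintegralD//; last 2 first.
- by apply: integrable_EFinZ => //; exact: integrable_one_step cF bF.
- by apply: integrable_EFinZ => //; exact: integrable_one_step cF bF.
apply: le_Rintegral => //.
- apply: (@integrable_perspective R _ (measurableTypeR R) nu F M cF bF).
  + by move=> x; apply: mixture_gt0 => //; exact: mixing_density_lincomb.
  + by move=> x; apply: mixture_gt0 => //; exact: mixing_density_lincomb.
  + by apply: integrable_mixture => //; exact: mixing_density_lincomb.
  + by apply: integrable_mixture => //; exact: mixing_density_lincomb.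
- by apply: integrable_EFinD => //; apply: integrable_EFinZ => //;
    exact: integrable_one_step cF bF.
- move=> x _; rewrite /om2 !mixture_lincomb//.
  by apply: perspective_convex => //; exact: mixture_gt0.
Qed.

End one_step_posterior.

(** * Equality of weighted image measures, from a pi-system to functions *)

Section weighted_pushforward.
Context {d d1 d2 : measure_display} {T : measurableType d}
  {T1 : measurableType d1} {T2 : measurableType d2} {R : realType}.
Variables (m1 : {measure set T1 -> \bar R}) (m2 : {measure set T2 -> \bar R}).
Variables (g1 : T1 -> T) (g2 : T2 -> T).
Variables (k1 : T1 -> R) (k2 : T2 -> R).
Hypotheses (mg1 : measurable_fun setT g1) (mg2 : measurable_fun setT g2).
Hypotheses (mk1 : measurable_fun setT k1) (mk2 : measurable_fun setT k2).
Hypotheses (k10 : forall x, 0 <= k1 x) (k20 : forall x, 0 <= k2 x).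

Let mpre1 S : measurable S -> measurable (g1 @^-1` S).
Proof. by move=> mS; rewrite -[X in measurable X]setTI; exact: mg1. Qed.

Let mpre2 S : measurable S -> measurable (g2 @^-1` S).
Proof. by move=> mS; rewrite -[X in measurable X]setTI; exact: mg2. Qed.

(** Dynkin's argument; the finite total mass permits the subtraction for complements. The two base
    spaces differ so that the sample space can be compared with its product with the observation
    space. *)
Lemma weighted_pushforward_pi_system (G : set (set T)) :
  @measurable _ T = <<s G >> -> setI_closed G -> G setT ->
  (\int[m1]_x (k1 x)%:E < +oo)%E ->
  (forall S, G S ->
    \int[m1]_(x in g1 @^-1` S) (k1 x)%:E = \int[m2]_(x in g2 @^-1` S) (k2 x)%:E)%E ->
  forall S, measurable S ->
    (\int[m1]_(x in g1 @^-1` S) (k1 x)%:E = \int[m2]_(x in g2 @^-1` S) (k2 x)%:E)%E.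
Proof.
move=> mG GI GT fin12 GE S; rewrite {1}mG.
pose P S := (\int[m1]_(x in g1 @^-1` S) (k1 x)%:E = \int[m2]_(x in g2 @^-1` S) (k2 x)%:E)%E.
have splitI d' (T' : measurableType d') (m : {measure set T' -> \bar R})
    (k : T' -> R) (A : set T') : measurable A -> measurable_fun setT k ->
    (forall x, 0 <= k x) ->
    (\int[m]_x (k x)%:E =
     \int[m]_(x in A) (k x)%:E + \int[m]_(x in ~` A) (k x)%:E)%E.
  move=> mA mk k0; rewrite -ge0_integral_setU//.
  - by rewrite setUv.
  - exact: measurableC.
  - by rewrite setUv; exact/measurable_EFinP.
  - by move=> x _; rewrite lee_fin.
  - by apply/disj_setPS; rewrite setICr.
apply: (@dynkin_induction _ T G P mG GI) => //.
- exact: GE.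
- move=> A mA PA; rewrite /P -(preimage_setC g1) -(preimage_setC g2).
  have e1 := splitI _ _ m1 k1 _ (mpre1 mA) mk1 k10.
  have e2 := splitI _ _ m2 k2 _ (mpre2 mA) mk2 k20.
  have eT : (\int[m1]_x (k1 x)%:E = \int[m2]_x (k2 x)%:E)%E by exact: GE GT.
  have f1 : (\int[m1]_(x in g1 @^-1` A) (k1 x)%:E)%E \is a fin_num.
    rewrite ge0_fin_numE ?integral_ge0//.
    apply: le_lt_trans fin12; apply: ge0_subset_integral => //.
    - exact: mpre1.
    - exact/measurable_EFinP.
    - by move=> x _; rewrite lee_fin.
    - by move=> x _; rewrite lee_fin.
  have cancel x : (\int[m1]_(x in g1 @^-1` A) (k1 x)%:E + x -
      \int[m1]_(x in g1 @^-1` A) (k1 x)%:E = x)%E.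
    by rewrite addeAC (subee f1) add0e.
  by rewrite -[LHS]cancel -e1 eT e2 -PA cancel.
- move=> F mF tF PF; rewrite /P !preimage_bigcup.
  rewrite !ge0_integral_bigcup//.
  + by apply: eq_eseriesr => i _; exact: PF.
  + by move=> i; exact: mpre2.
  + by apply/measurable_EFinP; exact: measurable_funTS.
  + by move=> x _; rewrite lee_fin.
  + by move=> i j _ _ [x [xi xj]]; apply: tF => //; exists (g2 x).
  + by move=> i; exact: mpre1.
  + by apply/measurable_EFinP; exact: measurable_funTS.
  + by move=> x _; rewrite lee_fin.
  + by move=> i j _ _ [x [xi xj]]; apply: tF => //; exists (g1 x).
Qed.

Import HBNNSimple.

Lemma weighted_pushforward_fun :
  (forall S, measurable S ->
    \int[m1]_(x in g1 @^-1` S) (k1 x)%:E = \int[m2]_(x in g2 @^-1` S) (k2 x)%:E)%E ->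
  forall f : T -> \bar R, measurable_fun setT f -> (forall x, 0 <= f x)%E ->
  (\int[m1]_x (f (g1 x) * (k1 x)%:E) = \int[m2]_x (f (g2 x) * (k2 x)%:E))%E.
Proof.
move=> SE f mf f0.
pose f_ := nnsfun_approx measurableT mf.
have approx d' (T' : measurableType d') (m : {measure set T' -> \bar R})
    (g : T' -> T) (k : T' -> R) : measurable_fun setT g ->
    measurable_fun setT k -> (forall x, 0 <= k x) ->
    (\int[m]_x (f (g x) * (k x)%:E) =
     limn (fun n => \int[m]_x ((f_ n (g x) * k x)%:E)))%E.
  move=> mg mk k0.
  rewrite -monotone_convergence//.
  - apply: eq_integral => x _; apply/esym/cvg_lim => //.
    under eq_fun do rewrite EFinM.
    by apply: cvgeZr => //; exact: cvg_nnsfun_approx.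
  - move=> n; apply/measurable_EFinP; apply: measurable_funM => //.
    exact: measurableT_comp.
  - by move=> n x _; rewrite lee_fin mulr_ge0.
  - move=> x _ a b ab; rewrite lee_fin ler_wpM2r//.
    exact/lefP/nd_nnsfun_approx.
rewrite (approx _ _ m1 g1 k1)// (approx _ _ m2 g2 k2)//.
congr (limn _); apply/funext => n.
have simple d' (T' : measurableType d') (m : {measure set T' -> \bar R})
    (g : T' -> T) (k : T' -> R) : measurable_fun setT g ->
    measurable_fun setT k -> (forall x, 0 <= k x) ->
    (\int[m]_x (f_ n (g x) * k x)%:E = \sum_(r \in range (f_ n))
       r%:E * \int[m]_(x in g @^-1` (f_ n @^-1` [set r])) (k x)%:E)%E.
  move=> mg mk k0.
  have mpre r : measurable (g @^-1` (f_ n @^-1` [set r])).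
    by rewrite -[X in measurable X]setTI; exact: mg.
  have m1g r : measurable_fun setT
      (\1_(g @^-1` (f_ n @^-1` [set r])) : T' -> R) by exact: measurable_indic.
  have term0 r x : (0 <= (r * \1_(f_ n @^-1` [set r]) (g x))%:E)%E.
    exact: (nnfun_muleindic_ge0 (f_ n)).
  under eq_integral => x _.
    rewrite EFinM (fimfunE (f_ n) (g x)) -fsumEFin// ge0_mule_fsuml; last first.
      by move=> r; exact: term0.
    over.
  rewrite ge0_integral_fsum//; last 2 first.
  - move=> r; apply/measurable_EFinP; apply: measurable_funM => //.
    exact: (measurable_funM (measurable_cst _) (m1g r)).
  - by move=> r x _; rewrite mule_ge0// lee_fin.
  apply: eq_fsbigr => r /set_mem[z _ zr].
  have r0 : 0 <= r by rewrite -zr.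
  under eq_integral do rewrite EFinM -muleA.
  rewrite ge0_integralZl_EFin//.
  - congr (_ * _)%E; rewrite [RHS]integral_mkcond; apply: eq_integral => x _.
    by rewrite epatch_indic /= muleC.
  - by move=> x _; rewrite mule_ge0// lee_fin.
  - apply/measurable_EFinP; apply: (measurable_funM (m1g r)) => //.
rewrite (simple _ _ m1 g1 k1)// (simple _ _ m2 g2 k2)//.
by apply: eq_fsbigr => r _; rewrite SE.
Qed.

End weighted_pushforward.

(** * Posterior expectations of likelihoods and their update by an observation *)

Section prediction.
Context {R : realType}.
Variables (nu : {sigma_finite_measure set (measurableTypeR R) -> \bar R})
  (mu : probability (measurableTypeR R) R) (theta0 : R).
Hypothesis nu_neq0 : nu [set: R] <> 0%E.
Hypothesis mu_concentrated : mu (natural_domain nu)° = 1%E.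
Hypothesis mu_plus : (0 < mu (supp_plus mu theta0) < 1)%E.
Hypothesis weight_fin : forall (n : nat) (y : R),
  (\int[mu]_(u in msupport mu) (weight nu n y u)%:E < +oo)%E.
Local Notation K := (carrier nu mu).
Local Notation mass := (mass nu mu).
Local Notation density := (post_density nu mu).
Local Notation mix := (mixture nu mu).
Implicit Types (C : set (measurableTypeR R)) (phi : R -> R).

Let mK : measurable K.
Proof. exact: measurable_carrier. Qed.
Let M0 n y : 0 < mass K n y.
Proof. exact: mass_carrier_gt0 mu_concentrated mu_plus weight_fin n y. Qed.
Let gK n y : mixing_density nu mu K (density n y).
Proof.
exact: (post_density_mixing mu_concentrated mu_plus weight_fin n y mK (fun u h => h)).
Qed.
Let d0 n y u : 0 <= density n y u.
Proof.
exact/ltW/(post_density_gt0 mu_concentrated mu_plus weight_fin).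
Qed.
Let KN : K `<=` natural_domain nu.
Proof. exact: carrier_natural_domain. Qed.

Definition likelihood u C := \int[nu]_(x in C) expdens nu u x.

Lemma likelihood_ge0 u C : 0 <= likelihood u C.
Proof. by apply: Rintegral_ge0 => x _; exact: expR_ge0. Qed.

Lemma measurable_expdens2 :
  measurable_fun [set: measurableTypeR R * measurableTypeR R]
    (fun z => expdens nu z.1 z.2).
Proof.
apply: measurableT_comp => //; apply: measurable_funB.
  exact: measurable_funM.
by apply: measurableT_comp => //; exact: measurable_logLaplace.
Qed.

Lemma measurable_likelihood C : measurable C ->
  measurable_fun [set: measurableTypeR R] (likelihood ^~ C).
Proof.
move=> mC; apply: measurableT_comp => //.
have := @measurable_integral_in _ _ (measurableTypeR R) (measurableTypeR R) R nu
  (fun z => (expdens nu z.1 z.2)%:E) _ _ C mC; apply.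
- by apply/measurable_EFinP; exact: measurable_expdens2.
- by move=> z; rewrite lee_fin expR_ge0.
Qed.

Lemma integral_expdens_le1 u C : natural_domain nu u -> measurable C ->
  (\int[nu]_(x in C) (expdens nu u x)%:E <= 1)%E.
Proof.
move=> Nu mC; rewrite -(expdens_integral nu_neq0 Nu).
apply: ge0_subset_integral => //.
- by apply/measurable_EFinP; exact: measurable_expdens.
- by move=> x _; rewrite lee_fin expR_ge0.
Qed.

Lemma likelihoodE u C : natural_domain nu u -> measurable C ->
  ((likelihood u C)%:E = \int[nu]_(x in C) (expdens nu u x)%:E)%E.
Proof.
move=> Nu mC; rewrite /likelihood /Rintegral fineK// ge0_fin_numE.
  by rewrite (le_lt_trans (integral_expdens_le1 Nu mC)) ?ltry.
by apply: integral_ge0 => x _; rewrite lee_fin expR_ge0.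
Qed.

Lemma likelihood_le1 u C : natural_domain nu u -> measurable C ->
  likelihood u C <= 1.
Proof.
by move=> Nu mC; rewrite -lee_fin likelihoodE//; exact: integral_expdens_le1.
Qed.

Definition predict phi n y := \int[mu]_(u in K) (density n y u * phi u).

(** The upper bound is restricted to the natural domain because elsewhere [expdens] is not a
    probability density and likelihoods may exceed 1. *)
Definition test_function phi := [/\ measurable_fun [set: measurableTypeR R] phi,
  (forall u, 0 <= phi u) & (forall u, natural_domain nu u -> phi u <= 1)].

Lemma test_likelihood phi C : measurable C -> test_function phi ->
  test_function (fun u => likelihood u C * phi u).
Proof.
move=> mC [mp p0 p1]; split.
- by apply: measurable_funM => //; exact: measurable_likelihood.
- by move=> u; rewrite mulr_ge0// likelihood_ge0.
- move=> u Nu; rewrite -[leRHS]mulr1; apply: ler_pM => //.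
    exact: likelihood_ge0.
  exact: likelihood_le1.
  exact: p1.
Qed.

Lemma test_function1 : test_function (fun=> 1).
Proof. by split. Qed.

Lemma predict_ge0 phi n y : test_function phi -> 0 <= predict phi n y.
Proof.
move=> [_ p0 _]; apply: Rintegral_ge0 => u _.
by rewrite mulr_ge0.
Qed.

Lemma integrable_test (E : set (measurableTypeR R)) (g : R -> R) phi :
  measurable E -> E `<=` natural_domain nu -> test_function phi ->
  (forall u, 0 <= g u) -> mu.-integrable E (EFin \o g) ->
  mu.-integrable E (EFin \o (fun u => g u * phi u)).
Proof.
move=> mE EN [mp p0 p1] g0 ig.
apply: (@le_integrable_EFin _ _ (measurableTypeR R) mu E _ g) => //.
- apply: measurable_funM; first exact: integrable_EFin_measurable ig.
  exact: measurable_funTS.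
- move=> u /EN Nu; rewrite ger0_norm ?mulr_ge0//.
  by rewrite ler_piMr// p1.
Qed.

Lemma predictE phi n y : test_function phi ->
  ((predict phi n y)%:E = \int[mu]_(u in K) (density n y u * phi u)%:E)%E.
Proof.
move=> tp; rewrite /predict /Rintegral fineK//.
apply: integrable_fin_num => //; apply: integrable_test => //.
by case: (gK n y).
Qed.

Lemma measurable_mass n :
  measurable_fun [set: measurableTypeR R] (mass K n).
Proof.
apply: continuous_measurable_fun; exact: continuous_mass.
Qed.

Lemma measurable_predict phi n : test_function phi ->
  measurable_fun [set: measurableTypeR R] (predict phi n).
Proof.
move=> tp; have [mp p0 p1] := tp.
have -> : predict phi n = (fun y =>
    (\int[mu]_(u in K) (weight nu n y u * phi u)) / mass K n y).
  apply/funext => y; rewrite /predict mulrC -RintegralZl//.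
    apply: eq_Rintegral => u _.
    by rewrite (post_densityE mu_concentrated) mulrA.
  apply: integrable_test => //; first by move=> u; exact/ltW/weight_gt0.
  exact: integrable_weight.
apply: measurable_fun_div; [|exact: measurable_mass|exact: M0].
apply: measurableT_comp => //.
have := @measurable_integral_in _ _ (measurableTypeR R) (measurableTypeR R) R mu
  (fun z => (weight nu n z.1 z.2 * phi z.2)%:E) _ _ K mK; apply.
- apply/measurable_EFinP; apply: measurable_funM; last exact: measurableT_comp.
  apply: measurableT_comp => //; apply: measurable_funB.
    exact: measurable_funM.
  apply: measurable_funM => //.
  by apply: measurableT_comp => //; exact: measurable_logLaplace.
- by move=> z; rewrite lee_fin mulr_ge0// ltW// weight_gt0.
Qed.

(** Bayes' rule: the predictive density is the factor that undoes the normalisation of the updated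
    posterior. *)
Lemma mixture_predict phi n y x : test_function phi ->
  ((mix K (density n y) x * predict phi n.+1 (y + x))%:E =
   \int[mu]_(u in K) (density n y u * phi u * expdens nu u x)%:E)%E.
Proof.
move=> tp; rewrite EFinM (predictE n.+1 (y + x) tp) -ge0_integralZl_EFin//.
- apply: eq_integral => u _; rewrite -EFinM; congr EFin.
  rewrite [RHS]mulrAC (post_density_expdens mu_concentrated n y x u).
  rewrite (post_densityE mu_concentrated n.+1 (y + x) u).
  rewrite (mixture_post_density mu_concentrated weight_fin n y x mK (fun u h => h)).
  have b0 := M0 n.+1 (y + x); rewrite !mulrA; congr (_ * _ * _).
  by rewrite mulrAC mulfV ?mul1r// gt_eqF.
- by move=> u _; have [_ p0 _] := tp; rewrite lee_fin mulr_ge0.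
- apply/measurable_EFinP/measurable_funTS; have [mp _ _] := tp.
  by apply: measurable_funM => //; exact: measurable_post_density.
- by apply: Rintegral_ge0 => u _; rewrite mulr_ge0// expR_ge0.
Qed.

(** Bayes' rule and Tonelli give this tower property, which absorbs one more observation in the
    induction for the Markov property. *)
Lemma predict_step phi n y C : measurable C -> test_function phi ->
  (\int[nu]_(x in C) (mix K (density n y) x * predict phi n.+1 (y + x))%:E =
   (predict (fun u => likelihood u C * phi u) n y)%:E)%E.
Proof.
move=> mC tp; have [mp p0 p1] := tp.
rewrite predictE; last exact: test_likelihood.
under eq_integral do rewrite mixture_predict//.
rewrite (@tonelli_in _ _ (measurableTypeR R) (measurableTypeR R) R nu mu
  (fun z => (density n y z.2 * phi z.2 * expdens nu z.2 z.1)%:E))//=.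
- apply: eq_integral => u /set_mem/KN Nu.
  under eq_integral do rewrite EFinM.
  rewrite ge0_integralZl_EFin//.
  + by rewrite -likelihoodE// -EFinM mulrAC -mulrA.
  + by move=> x _; rewrite lee_fin expR_ge0.
  + by apply/measurable_EFinP/measurable_funTS; exact: measurable_expdens.
  + by rewrite mulr_ge0.
- apply/measurable_EFinP; apply: (@measurable_mixture_integrand _ nu
    (fun u => density n y u * phi u)).
  by apply: measurable_funM => //; exact: measurable_post_density.
- by move=> z; rewrite lee_fin; apply: mulr_ge0; [exact: mulr_ge0|exact: expR_ge0].
Qed.

Lemma integral_mixture_likelihood n y C : measurable C ->
  (\int[nu]_(x in C) (mix K (density n y) x)%:E =
   (predict (likelihood ^~ C) n y)%:E)%E.
Proof.
move=> mC; rewrite integral_mixture// predictE; last first.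
  split; [exact: measurable_likelihood|by move=> u; exact: likelihood_ge0|].
  by move=> u Nu; exact: likelihood_le1.
by apply: eq_integral => u /set_mem/KN Nu; rewrite EFinM -likelihoodE.
Qed.

End prediction.

(** * The observation filtration and the running sum adapted to it *)

Section filtration.
Context {R : realType} {d : measure_display} {Omega : measurableType d}.
Variables (X : nat -> {mfun Omega >-> measurableTypeR R}) (n : nat).
Local Notation F := (obs_sigma_algebra X n).

Definition obs_events k : set (set Omega) :=
  \bigcup_(i in `I_k) preimage_set_system setT (X (n + i).+1) measurable.

Lemma measurable_obs k E : F k E -> measurable E.
Proof.
apply: smallest_sub; first exact: sigma_algebra_measurable.
move=> _ [i _ [B mB <-]].
by apply: measurable_funP.
Qed.

Lemma obs_setI k E E' : F k E -> F k E' -> F k (E `&` E').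
Proof. exact: (@measurableI _ (g_sigma_algebraType (obs_events k))). Qed.

Lemma obs_setT k : F k setT.
Proof. exact: (@measurableT _ (g_sigma_algebraType (obs_events k))). Qed.

Lemma obs_setC k E : F k E -> F k (~` E).
Proof. exact: (@measurableC _ (g_sigma_algebraType (obs_events k))). Qed.

Lemma obs_le k l E : (k <= l)%N -> F k E -> F l E.
Proof.
move=> kl; apply: smallest_sub; first exact: smallest_sigma_algebra.
move=> A [i ik iA]; apply: sub_gen_smallest.
by exists i => //; exact: leq_trans kl.
Qed.

Lemma obs_preimage k i B : (i < k)%N -> measurable B ->
  F k (X (n + i).+1 @^-1` B).
Proof.
move=> ik mB; apply: sub_gen_smallest; exists i => //.
by exists B => //; rewrite setTI.
Qed.

Definition partial_sum (y : R) k (w : Omega) : R :=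
  y + \sum_(i < k) X (n + i).+1 w.

Lemma partial_sumS y k w :
  partial_sum y k.+1 w = partial_sum y k w + X (n + k).+1 w.
Proof. by rewrite /partial_sum big_ord_recr/= addrA. Qed.

Lemma obs_partial_sum y k (B : set (measurableTypeR R)) : measurable B ->
  F k (partial_sum y k @^-1` B).
Proof.
move=> mB.
have : @measurable_fun _ _ (g_sigma_algebraType (obs_events k))
    (measurableTypeR R) setT (partial_sum y k).
  apply: measurable_funD => //; apply: measurable_sum => i.
  by move=> _ C mC; rewrite setTI; exact: obs_preimage.
by move=> /(_ measurableT _ mB); rewrite setTI.
Qed.

Lemma measurable_partial_sum y k :
  measurable_fun setT (partial_sum y k : Omega -> measurableTypeR R).
Proof.
by move=> _ B mB; rewrite setTI; exact: measurable_obs (@obs_partial_sum y k B mB).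
Qed.

(** Splits off the nearest future observation, as [big_ord_recl] does for the product of
    likelihoods. *)
Lemma bigcap_predI j (C : nat -> set (measurableTypeR R)) C0 k :
  \bigcap_(i in `I_j.+1) (X (n + k + i).+1 @^-1`
     (fun i => if i is i'.+1 then C i' else C0) i) =
  X (n + k).+1 @^-1` C0 `&` \bigcap_(i in `I_j) (X (n + k.+1 + i).+1 @^-1` C i).
Proof.
apply/seteqP; split => w.
- move=> H; split; first by have := H 0%N isT; rewrite addn0.
  by move=> i ij; have := H i.+1 ij; rewrite !addnS addSn.
- move=> [w0 H] [|i] ij; first by rewrite addn0.
  by have := H i ij; rewrite !addnS addSn.
Qed.

End filtration.

(** * The Markov property of the time and running sum *)

Section markov_property.
Context {R : realType} {d : measure_display} {Omega : measurableType d}.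
Variables (nu : {sigma_finite_measure set (measurableTypeR R) -> \bar R})
  (mu : probability (measurableTypeR R) R) (theta0 : R).
Hypothesis nu_neq0 : nu [set: R] <> 0%E.
Hypothesis mu_concentrated : mu (natural_domain nu)° = 1%E.
Hypothesis mu_plus : (0 < mu (supp_plus mu theta0) < 1)%E.
Hypothesis weight_fin : forall (n : nat) (y : R),
  (\int[mu]_(u in msupport mu) (weight nu n y u)%:E < +oo)%E.
Variables (X : nat -> {mfun Omega >-> measurableTypeR R}) (n : nat) (y : R)
  (P : probability Omega R).
Local Notation F := (obs_sigma_algebra X n).
Local Notation K := (carrier nu mu).
Local Notation density := (post_density nu mu).
Local Notation mix := (mixture nu mu).
Local Notation Y := (partial_sum X n y).
Implicit Types (E : set Omega).

Definition likelihood_prod j (C : nat -> set (measurableTypeR R)) u :=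
  \prod_(i < j) likelihood nu u (C i).

Hypothesis law : forall j C, (forall i, measurable (C i)) ->
  (P (\bigcap_(i in `I_j) (X (n + i).+1 @^-1` C i)) =
   \int[mu]_u (density n y u * likelihood_prod j C u)%:E)%E.

Definition future k j (C : nat -> set (measurableTypeR R)) : set Omega :=
  \bigcap_(i in `I_j) (X (n + k + i).+1 @^-1` C i).

Lemma measurable_future k j C : (forall i, measurable (C i)) ->
  measurable (future k j C).
Proof.
move=> mC; apply: bigcap_measurableType => i _.
by rewrite -[X in measurable X]setTI; exact: measurable_funP.
Qed.

Lemma test_likelihood_prod j C : (forall i, measurable (C i)) ->
  test_function nu (likelihood_prod j C).
Proof.
move=> mC; elim: j C mC => [|j IH] C mC.
  rewrite (_ : likelihood_prod 0 C = fun=> 1); first exact: test_function1.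
  by apply/funext => u; rewrite /likelihood_prod big_ord0.
rewrite (_ : likelihood_prod j.+1 C =
  fun u => likelihood nu u (C 0%N) * likelihood_prod j (fun i => C i.+1) u).
  by apply: test_likelihood => //; exact: IH.
by apply/funext => u; rewrite /likelihood_prod big_ord_recl.
Qed.

(** Given the first [k] observations, the law of the next [j] depends only on the current state.
    Integrating over past events [E] expresses this without conditional expectations. *)
Definition prediction_formula k := forall E j C, F k E ->
  (forall i, measurable (C i)) ->
  (P (E `&` future k j C) =
   \int[P]_(w in E) (predict nu mu (likelihood_prod j C) (n + k) (Y k w))%:E)%E.

Lemma measurable_predict_sum j C k : (forall i, measurable (C i)) ->
  measurable_fun setT
    (fun w => predict nu mu (likelihood_prod j C) (n + k) (Y k w)).
Proof.
move=> mC; apply: (@measurableT_comp _ _ _ _ (measurableTypeR R) _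
  (predict nu mu (likelihood_prod j C) (n + k))).
  apply: (measurable_predict mu_concentrated mu_plus weight_fin).
  exact: test_likelihood_prod.
exact: measurable_partial_sum.
Qed.

Lemma predict_likelihood_ge0 j C k z : (forall i, measurable (C i)) ->
  0 <= predict nu mu (likelihood_prod j C) k z.
Proof.
move=> mC; apply: (predict_ge0 mu_concentrated mu_plus weight_fin).
exact: test_likelihood_prod.
Qed.

(** Both sides are finite measures in [E]. This is the pi-system lemma with identity maps into the
    space carrying the generated sigma-algebra. *)
Lemma sigma_algebra_induction (G : set (set Omega)) (A : set Omega) (h : Omega -> R) :
  G `<=` measurable -> setI_closed G -> G setT -> measurable A ->
  measurable_fun setT h -> (forall w, 0 <= h w) ->
  (forall E, G E -> (P (E `&` A) = \int[P]_(w in E) (h w)%:E)%E) ->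
  forall E, <<s G >> E -> (P (E `&` A) = \int[P]_(w in E) (h w)%:E)%E.
Proof.
move=> Gm GI GT mA mh h0 GE.
have sm : <<s G >> `<=` measurable.
  by apply: smallest_sub => //; exact: sigma_algebra_measurable.
have PA E : measurable E ->
    (\int[P]_(w in E) (\1_A w)%:E = P (E `&` A))%E.
  by move=> mE; rewrite integral_indic// setIC.
have mid : @measurable_fun _ _ Omega (g_sigma_algebraType G) setT id.
  by move=> _ S mS; rewrite setTI; exact: sm.
have H := @weighted_pushforward_pi_system _ _ _ (g_sigma_algebraType G) Omega
  Omega R P P id id \1_A h mid mid _ mh _ h0 G erefl GI GT _ _.
move=> E GsE; rewrite -PA; last exact: sm.
apply: H => //.
- by rewrite integral_indic// setIT (le_lt_trans (probability_le1 P mA))// ltry.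
- by move=> S GS; rewrite PA ?GE//; exact: Gm.
Qed.

Lemma prediction_formula0 : prediction_formula 0.
Proof.
move=> E j C FE mC.
apply: (@sigma_algebra_induction [set setT] (future 0 j C)
  (fun w => predict nu mu (likelihood_prod j C) (n + 0) (Y 0 w))).
- by move=> _ ->.
- by move=> _ _ -> ->; rewrite setTI.
- by [].
- exact: measurable_future.
- exact: measurable_predict_sum.
- by move=> w; exact: predict_likelihood_ge0.
- move=> _ ->; rewrite setTI /future.
  under eq_bigcapr do rewrite addn0.
  rewrite law//.
  under [RHS]eq_integral do rewrite /partial_sum big_ord0 addr0 addn0.
  rewrite integral_cst// [X in (_ * X)%E]probability_setT mule1.
  rewrite (predictE mu_concentrated mu_plus weight_fin); last first.
    exact: test_likelihood_prod.
  have [mp p0 _] := test_likelihood_prod j mC.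
  rewrite (integral_carrier mu_concentrated)// ?setTI//.
    apply/measurable_EFinP; apply: measurable_funM => //.
    exact: measurable_post_density.
  move=> u _; rewrite lee_fin mulr_ge0// ltW//.
  exact: (post_density_gt0 mu_concentrated mu_plus weight_fin).
(* With no observation the generating family is empty, so any sigma-algebra contains the one it
   generates. *)
- move: FE; apply: smallest_sub; first exact: smallest_sigma_algebra.
  by move=> A [].
Qed.

Lemma measurable_mixture2 k : measurable_fun
  [set: measurableTypeR R * measurableTypeR R]
  (fun z => mix K (density k z.1) z.2).
Proof.
rewrite (_ : (fun z => _) = (fun z : R * R => mass nu mu K k.+1 (z.1 + z.2) /
    mass nu mu K k z.1)); last first.
  apply/funext => z; rewrite (mixture_post_density mu_concentrated weight_fin)//.
  exact: measurable_carrier.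
apply: measurable_fun_div.
- apply: (@measurableT_comp _ _ _ _ (measurableTypeR R) _ (mass nu mu K k.+1)).
    exact: measurable_mass.
  exact: measurable_funD.
- apply: (@measurableT_comp _ _ _ _ (measurableTypeR R) _ (mass nu mu K k)) => //.
  exact: measurable_mass.
- by move=> z; exact: (mass_carrier_gt0 mu_concentrated mu_plus weight_fin).
Qed.

Lemma mixture_carrier_ge0 k z x : 0 <= mix K (density k z) x.
Proof.
apply: Rintegral_ge0 => u _; rewrite mulr_ge0 ?expR_ge0// ltW//.
exact: (post_density_gt0 mu_concentrated mu_plus weight_fin).
Qed.

Let XY k w : R * R := (Y k w, X (n + k).+1 w).

Let measurable_XY k : measurable_fun setT
  (XY k : Omega -> measurableTypeR R * measurableTypeR R).
Proof.
by apply/measurable_fun_pairP; split; [exact: measurable_partial_sum|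
  exact: measurable_funP].
Qed.

Let measurable_Yfst k : measurable_fun setT
  ((fun z => (Y k z.1, z.2)) :
    Omega * measurableTypeR R -> measurableTypeR R * measurableTypeR R).
Proof.
apply/measurable_fun_pairP; split; last exact: measurable_snd.
exact: (measurableT_comp (@measurable_partial_sum _ _ _ X n y k) measurable_fst).
Qed.

(** Density with respect to [P \x nu] of a fresh observation drawn, on [E], from the predictive law
    at the current state. *)
Let kernel k E (z : Omega * measurableTypeR R) : R :=
  \1_E z.1 * mix K (density (n + k) (Y k z.1)) z.2.

Let kernel_ge0 k E z : 0 <= kernel k E z.
Proof. by rewrite mulr_ge0// mixture_carrier_ge0. Qed.

Let measurable_kernel k E : measurable E -> measurable_fun setT (kernel k E).
Proof.
move=> mE; apply: measurable_funM; first exact: measurableT_comp.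
exact: (measurableT_comp (measurable_mixture2 (n + k)) (measurable_Yfst k)).
Qed.

(** The state paired with the true next observation, under [P] on [E], has the same image measure as
    the state paired with a fresh draw weighted by [kernel]. On rectangles this is the prediction
    formula with [j = 1]; the pushforward lemmas extend it to all nonnegative [f]. *)
Lemma prediction_markov k E (f : R * R -> \bar R) :
  prediction_formula k -> F k E ->
  measurable_fun [set: measurableTypeR R * measurableTypeR R] f ->
  (forall z, 0 <= f z)%E ->
  (\int[P]_(w in E) f (Y k w, X (n + k).+1 w) =
   \int[P]_(w in E) \int[nu]_x
     (f (Y k w, x) * (mix K (density (n + k) (Y k w)) x)%:E))%E.
Proof.
move=> Qk FE mf f0; have mE := measurable_obs FE.
have iterate (h : R * R -> \bar R) :
    measurable_fun [set: measurableTypeR R * measurableTypeR R] h ->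
    (forall z, 0 <= h z)%E ->
    (\int[P \x nu]_z (h (Y k z.1, z.2) * (kernel k E z)%:E) =
     \int[P]_(w in E) \int[nu]_x
       (h (Y k w, x) * (mix K (density (n + k) (Y k w)) x)%:E))%E.
  move=> mh h0.
  rewrite fubini_tonelli1; last 2 first.
  - apply: emeasurable_funM; first exact: (measurableT_comp mh (measurable_Yfst k)).
    by apply/measurable_EFinP; exact: measurable_kernel.
  - by move=> z; rewrite mule_ge0// lee_fin.
  rewrite [RHS]integral_mkcond; apply: eq_integral => w _.
  rewrite /fubini_F patchE /kernel /= indicE; case: ifPn => wE.
    by apply: eq_integral => x _; rewrite mul1r.
  by apply: integral0_eq => x _; rewrite mul0r mule0.
have -> : (\int[P]_(w in E) f (Y k w, X (n + k).+1 w) =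
    \int[P]_w (f (XY k w) * (\1_E w)%:E))%E.
  by rewrite integral_mkcond epatch_indic.
rewrite -iterate//.
have m1E : measurable_fun setT (\1_E : Omega -> R) by exact: measurable_indic.
apply: (@weighted_pushforward_fun _ _ _
  (measurableTypeR R * measurableTypeR R)%type Omega
  (Omega * measurableTypeR R)%type R P (P \x nu)%E (XY k)
  (fun z => (Y k z.1, z.2)) \1_E (kernel k E) (measurable_XY k)
  (measurable_Yfst k) m1E (measurable_kernel k mE) _ (kernel_ge0 k E)) => //.
apply: (@weighted_pushforward_pi_system _ _ _
  (measurableTypeR R * measurableTypeR R)%type Omega
  (Omega * measurableTypeR R)%type R P (P \x nu)%E (XY k)
  (fun z => (Y k z.1, z.2)) \1_E (kernel k E) (measurable_XY k)
  (measurable_Yfst k) m1E (measurable_kernel k mE) _ (kernel_ge0 k E) _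
  (measurable_prod_measurableType (measurableTypeR R) (measurableTypeR R))) => //.
- move=> _ _ [A1 mA1 [A2 mA2 <-]] [B1 mB1 [B2 mB2 <-]].
  exists (A1 `&` B1); first exact: measurableI.
  exists (A2 `&` B2); first exact: measurableI.
  by rewrite setXI.
- by exists setT => //; exists setT => //; rewrite setXTT.
- by rewrite integral_indic// setIT (le_lt_trans (probability_le1 P mE))// ltry.
- move=> _ [B mB [C mC <-]].
  have mBC : measurable (B `*` C : set (measurableTypeR R * measurableTypeR R)).
    exact: measurableX.
  transitivity (P ((E `&` Y k @^-1` B) `&` future k 1 (fun=> C))).
    rewrite integral_indic//; last first.
      by rewrite -[X in measurable X]setTI; exact: measurable_XY.
    congr (P _); apply/seteqP; split => w.
      by move=> [Ew [/= Bw Cw]]; split => // -[]//= _; rewrite addn0.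
    by move=> [[Ew Bw] /(_ 0%N isT)]; rewrite /= addn0.
  rewrite Qk//; last by apply: obs_setI => //; exact: obs_partial_sum.
  transitivity (\int[P \x nu]_z
      ((\1_(B `*` C) (Y k z.1, z.2))%:E * (kernel k E z)%:E))%E; last first.
    rewrite [RHS]integral_mkcond epatch_indic; apply: eq_integral => z _.
    by rewrite /= muleC.
  rewrite (iterate (EFin \o \1_(B `*` C))); last 2 first.
  - by apply/measurable_EFinP; exact: measurable_indic.
  - by move=> z; rewrite lee_fin.
  rewrite integral_mkcondr; apply: eq_integral => w _.
  rewrite epatch_indic /=.
  under [RHS]eq_integral do rewrite indicE in_setX.
  have [wB|wB] := boolP (w \in Y k @^-1` B).
    rewrite indicE wB mule1.
    have -> : predict nu mu (likelihood_prod 1 (fun=> C)) (n + k) (Y k w) =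
        predict nu mu (likelihood nu ^~ C) (n + k) (Y k w).
      by congr (predict _ _ _ _ _); apply/funext => u;
        rewrite /likelihood_prod big_ord1.
    rewrite -(integral_mixture_likelihood nu_neq0 mu_concentrated mu_plus weight_fin)//.
    rewrite [LHS]integral_mkcond epatch_indic; apply: eq_integral => x _.
    have -> : Y k w \in B by [].
    by rewrite /= indicE muleC.
  rewrite indicE (negbTE wB) mule0; apply/esym/integral0_eq => x _.
  have -> : (Y k w \in B) = false by exact: negbTE.
  by rewrite /= mul0e.
Qed.

(** Events of the past up to [k] intersected with an event of the next observation form a pi-system
    generating the next sigma-algebra. On these, that observation counts as the first of [j.+1]
    future ones, and [predict_step] with the Markov property reveals it. *)
Lemma prediction_formulaS k : prediction_formula k -> prediction_formula k.+1.
Proof.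
move=> Qk E j C FE mC.
pose G := [set A | exists E C0, [/\ F k E, measurable C0 &
  A = E `&` X (n + k).+1 @^-1` C0]].
apply: (@sigma_algebra_induction G (future k.+1 j C)
  (fun w => predict nu mu (likelihood_prod j C) (n + k.+1) (Y k.+1 w))).
- move=> _ [E' [C0 [FE' mC0 ->]]]; apply: measurableI.
    exact: measurable_obs FE'.
  by rewrite -[X in measurable X]setTI; exact: measurable_funP.
- move=> _ _ [E1 [C1 [FE1 mC1 ->]]] [E2 [C2 [FE2 mC2 ->]]].
  exists (E1 `&` E2), (C1 `&` C2); split.
  + exact: obs_setI.
  + exact: measurableI.
  + by rewrite setIACA preimage_setI.
- by exists setT, setT; split; [exact: obs_setT| |rewrite preimage_setT setIT].
- exact: measurable_future.
- exact: measurable_predict_sum.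
- by move=> w; exact: predict_likelihood_ge0.
- move=> _ [E' [C0 [FE' mC0 ->]]].
  pose C' i := if i is i'.+1 then C i' else C0.
  have mC' i : measurable (C' i) by case: i.
  rewrite -setIA -bigcap_predI -/(future k j.+1 C') (Qk _ _ _ FE' mC').
  have tC := test_likelihood_prod j mC.
  pose f (z : R * R) := ((\1_C0 z.2 *
    predict nu mu (likelihood_prod j C) (n + k).+1 (z.1 + z.2))%:E : \bar R).
  have mf : measurable_fun [set: measurableTypeR R * measurableTypeR R] f.
    apply/measurable_EFinP; apply: measurable_funM.
      have mi : measurable_fun setT (\1_C0 : measurableTypeR R -> R).
        exact: measurable_indic.
      exact: (measurableT_comp mi measurable_snd).
    apply: (@measurableT_comp _ _ _ _ (measurableTypeR R) _
      (predict nu mu (likelihood_prod j C) (n + k).+1)).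
      exact: (measurable_predict mu_concentrated mu_plus weight_fin).
    exact: measurable_funD.
  have f0 z : (0 <= f z)%E by rewrite lee_fin mulr_ge0// predict_likelihood_ge0.
  transitivity (\int[P]_(w in E') f (Y k w, X (n + k).+1 w))%E; last first.
    rewrite integral_mkcondr; apply: eq_integral => w _.
    by rewrite /f epatch_indic /= partial_sumS addnS EFinM muleC.
  rewrite prediction_markov//; apply: eq_integral => w _.
  have -> : predict nu mu (likelihood_prod j.+1 C') (n + k) (Y k w) =
      predict nu mu (fun u => likelihood nu u C0 * likelihood_prod j C u)
        (n + k) (Y k w).
    by congr (predict _ _ _ _ _); apply/funext => u;
      rewrite /likelihood_prod big_ord_recl.
  rewrite -(predict_step nu_neq0 mu_concentrated mu_plus weight_fin _ _ mC0 tC).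
  rewrite [LHS]integral_mkcond epatch_indic; apply: eq_integral => x _.
  by rewrite /f /= -!EFinM; congr EFin; rewrite mulrC mulrCA mulrC.
- move: FE; apply: smallest_sub; first exact: smallest_sigma_algebra.
  move=> A [i /= ik [B mB <-]]; apply: sub_gen_smallest; rewrite setTI.
  move: ik; rewrite ltnS leq_eqVlt => /predU1P[->|ik].
    by exists setT, B; split; [exact: obs_setT| |rewrite setTI].
  exists (X (n + i).+1 @^-1` B), setT; split; [exact: obs_preimage| |].
    by [].
  by rewrite preimage_setT setIT.
Qed.

Lemma prediction_formula_all k : prediction_formula k.
Proof. elim: k => [|k]; [exact: prediction_formula0|exact: prediction_formulaS]. Qed.

End markov_property.

(** * Closure properties of convexity used in the Bellman recursion *)

Section convex01_closure.
Context {R : realType}.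
Implicit Types F G : R -> R.

Lemma convex01_max F G : convex01 F -> convex01 G ->
  convex01 (fun p => Num.max (F p) (G p)).
Proof.
move=> cF cG a b t a01 b01 t01; case/andP: (t01) => t0 t1.
have t1' : 0 <= 1 - t by rewrite subr_ge0.
rewrite ge_max; apply/andP; split.
- apply: (le_trans (cF a b t a01 b01 t01)).
  by apply: lerD; apply: ler_wpM2l => //; rewrite le_max lexx.
- apply: (le_trans (cG a b t a01 b01 t01)).
  by apply: lerD; apply: ler_wpM2l => //; rewrite le_max lexx orbT.
Qed.

Lemma convex01_affine (a0 b0 : R) : convex01 (fun p => a0 * p + b0).
Proof. by move=> a b t _ _ _; rewrite le_eqVlt; apply/orP; left; apply/eqP; ring. Qed.

Lemma convex01_addl (c : R) F : convex01 F -> convex01 (fun p => F p - c).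
Proof. by move=> cF a b t a01 b01 t01; have := cF a b t a01 b01 t01; lra. Qed.

Lemma eq_convex01 F G : (forall p, 0 < p < 1 -> F p = G p) ->
  convex01 F -> convex01 G.
Proof.
move=> FG cF a b t a01 b01 t01; rewrite -!FG//; last exact: conv01.
exact: cF.
Qed.

End convex01_closure.

(** * Finite-horizon dynamic programming: concavity and monotonicity in time *)

Section bellman_equation.
Context {R : realType}.
Variables (nu : {sigma_finite_measure set (measurableTypeR R) -> \bar R})
  (mu : probability (measurableTypeR R) R) (theta0 c : R).
Hypothesis nu_neq0 : nu [set: R] <> 0%E.
Hypothesis mu_concentrated : mu (natural_domain nu)° = 1%E.
Hypothesis mu_plus : (0 < mu (supp_plus mu theta0) < 1)%E.
Hypothesis weight_fin : forall (n : nat) (y : R),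
  (\int[mu]_(u in msupport mu) (weight nu n y u)%:E < +oo)%E.
Hypothesis c_gt0 : 0 < c.
Local Notation K := (carrier nu mu).
Local Notation q := (post_prob nu mu theta0).
Local Notation density := (post_density nu mu).
Local Notation mix := (mixture nu mu).
Local Notation level := (level nu mu theta0).
Local Notation value_next := (one_step nu mu theta0).

Definition risk k y := Num.min (q k y) (1 - q k y).

(* [bellman j k y] is the optimal cost from state [(k, y)] when at most [j] more
   observations are allowed. *)
Fixpoint bellman j k y : R :=
  if j is j'.+1 then Num.min (risk k y)
    (c + \int[nu]_x (mix K (density k y) x * bellman j' k.+1 (y + x)))
  else risk k y.

(** The posterior probability is the coordinate in which the cost is concave and in which different
    times can be compared. *)
Definition bellman_at j k p := bellman j k (level k p).

Lemma bellman_atE j k y : bellman j k y = bellman_at j k (q k y).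
Proof.
by rewrite /bellman_at (level_post_prob mu_concentrated mu_plus weight_fin).
Qed.

Lemma risk_ge0 k y : 0 <= risk k y.
Proof.
have := post_prob01 mu_concentrated mu_plus weight_fin k y.
by rewrite /risk; move: (q k y) => p /andP[p0 p1]; rewrite le_min; lra.
Qed.

Lemma bellman_le_risk j k y : bellman j k y <= risk k y.
Proof. by case: j => [|j] //=; rewrite ge_min lexx. Qed.

Lemma risk_le1 k y : risk k y <= 1.
Proof.
have := post_prob01 mu_concentrated mu_plus weight_fin k y.
by rewrite /risk; move: (q k y) => p /andP[p0 p1]; rewrite ge_min ltW.
Qed.

Let mixture_ge0 k y x : 0 <= mix K (density k y) x :=
  mixture_carrier_ge0 mu_concentrated mu_plus weight_fin k y x.

Lemma bellman_ge0 j k y : 0 <= bellman j k y.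
Proof.
elim: j k y => [|j IH] k y /=; first exact: risk_ge0.
rewrite le_min risk_ge0/= addr_ge0 ?(ltW c_gt0)//; apply: Rintegral_ge0 => x _.
by rewrite mulr_ge0// mixture_ge0.
Qed.

Lemma bellman_at_norm j k p : `|- bellman_at j k p| <= 1.
Proof.
rewrite normrN ger0_norm; last exact: bellman_ge0.
exact: le_trans (bellman_le_risk _ _ _) (risk_le1 _ _).
Qed.

(** The double negation turns the concave cost into a convex function, to which the one-step results
    apply. *)
Lemma bellman_continuation j k y :
  \int[nu]_x (mix K (density k y) x * bellman j k.+1 (y + x)) =
  - value_next (fun p => - bellman_at j k.+1 p) k y.
Proof.
have -> : value_next (fun p => - bellman_at j k.+1 p) k y =
    \int[nu]_x (- (mix K (density k y) x * bellman j k.+1 (y + x))).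
  apply: eq_Rintegral => x _.
  rewrite (perspective_mixture mu_concentrated mu_plus weight_fin) mulrN.
  by rewrite bellman_atE.
rewrite /Rintegral; under [in RHS]eq_integral do rewrite EFinN.
rewrite integral_ge0N ?fineN ?opprK// => x _.
by rewrite lee_fin mulr_ge0 ?mixture_ge0 ?bellman_ge0.
Qed.

Lemma bellman_atS j k p : 0 < p < 1 -> bellman_at j.+1 k p =
  Num.min (Num.min p (1 - p))
    (c - value_next (fun p => - bellman_at j k.+1 p) k (level k p)).
Proof.
move=> p01; rewrite /bellman_at /= bellman_continuation /risk.
by rewrite (post_prob_level mu_concentrated mu_plus weight_fin).
Qed.

Lemma bellman_at0 k p : 0 < p < 1 -> bellman_at 0 k p = Num.min p (1 - p).
Proof.
move=> p01; rewrite /bellman_at /= /risk.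
by rewrite (post_prob_level mu_concentrated mu_plus weight_fin).
Qed.

Lemma bellman_concave j k : convex01 (fun p => - bellman_at j k p).
Proof.
have c0 : convex01 (fun p : R => Num.max (- p) (p - 1)).
  apply: convex01_max.
    by apply: eq_convex01 (convex01_affine (-1) 0) => p _; ring.
  by apply: eq_convex01 (convex01_affine 1 (-1)) => p _; ring.
elim: j k => [|j IH] k.
  apply: eq_convex01 c0 => p p01; rewrite bellman_at0// oppr_min.
  by congr Num.max; ring.
apply: (@eq_convex01 _ (fun p => Num.max (Num.max (- p) (p - 1))
    (value_next (fun p => - bellman_at j k.+1 p) k (level k p) - c))).
  move=> p p01; rewrite bellman_atS// !oppr_min.
  by congr (Num.max (Num.max _ _) _); ring.
apply: convex01_max => //; apply: convex01_addl.
apply: (one_step_convex nu_neq0 mu_concentrated mu_plus weight_fin _ (IH k.+1)).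
by move=> r _; exact: bellman_at_norm.
Qed.

Lemma bellman_mono j m n p : 0 < p < 1 -> (m <= n)%N ->
  bellman_at j m p <= bellman_at j n p.
Proof.
elim: j m n p => [|j IH] m n p p01 mn; first by rewrite !bellman_at0.
apply: (etrans (congr2 (fun a b => a <= b)
  (bellman_atS j m p01) (bellman_atS j n p01))).
apply: le_min2; first exact: lexx.
rewrite lerD2l lerN2.
(* The time inside the future cost changes first, under a fixed predictive law, by the induction
   hypothesis; then the predictive law changes, by [one_step_antitone]. *)
apply: (@le_trans _ _ (value_next (fun p => - bellman_at j m.+1 p) n (level n p))).
  rewrite /one_step; apply: le_Rintegral; first exact: measurableT.
  - apply: (integrable_one_step nu_neq0 mu_concentrated mu_plus weight_fin).
      exact: bellman_concave.
    by move=> r _; exact: bellman_at_norm.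
  - apply: (integrable_one_step nu_neq0 mu_concentrated mu_plus weight_fin).
      exact: bellman_concave.
    by move=> r _; exact: bellman_at_norm.
  - move=> x _; rewrite !(perspective_mixture mu_concentrated mu_plus weight_fin).
    apply: ler_wpM2l; first exact: mixture_ge0.
    rewrite lerN2; apply: IH => //.
    exact: (post_prob01 mu_concentrated mu_plus weight_fin).
apply: (one_step_antitone nu_neq0 mu_concentrated mu_plus weight_fin
  (bellman_concave j m.+1) _ mn).
  by move=> r _; exact: bellman_at_norm.
by rewrite !(post_prob_level mu_concentrated mu_plus weight_fin).
Qed.

Lemma measurable_post_prob k : measurable_fun [set: measurableTypeR R] (q k).
Proof.
apply: continuous_measurable_fun.
exact: (continuous_post_prob mu_concentrated mu_plus weight_fin).
Qed.

Lemma measurable_convex_post_prob F k : convex01 F ->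
  measurable_fun [set: measurableTypeR R] (fun y => F (q k y)).
Proof.
move=> cF; apply: (@measurable_comp _ _ _ (measurableTypeR R) R R
  (`]0, 1[%classic : set R) F setT (q k)) => //.
- move=> _ [y _ <-]; rewrite /= in_itv/=.
  exact: (post_prob01 mu_concentrated mu_plus weight_fin).
- exact: measurable_convex01.
- exact: measurable_post_prob.
Qed.

(** Measurability comes from concavity in the posterior probability, which is itself continuous in
    [y]. *)
Lemma measurable_bellman j k :
  measurable_fun [set: measurableTypeR R] (bellman j k).
Proof.
rewrite (_ : bellman j k = (fun y => - - bellman_at j k (q k y))); last first.
  by apply/funext => y; rewrite opprK bellman_atE.
apply: measurable_funN => //.
exact: (measurable_convex_post_prob _ (bellman_concave j k)).
Qed.

Definition continuation j k z :=
  \int[nu]_x (mix K (density k z) x * bellman j k.+1 (z + x)).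

Lemma continuation_ge0 j k z : 0 <= continuation j k z.
Proof.
by apply: Rintegral_ge0 => x _; rewrite mulr_ge0 ?mixture_ge0 ?bellman_ge0.
Qed.

Lemma measurable_continuation j k :
  measurable_fun [set: measurableTypeR R] (continuation j k).
Proof.
pose G p := value_next (fun p => - bellman_at j k.+1 p) k (level k p).
have -> : continuation j k = (fun z => - G (q k z)).
  apply/funext => z; rewrite /continuation bellman_continuation /G.
  by rewrite (level_post_prob mu_concentrated mu_plus weight_fin).
apply: measurable_funN => //; apply: measurable_convex_post_prob.
apply: (one_step_convex nu_neq0 mu_concentrated mu_plus weight_fin _
  (bellman_concave j k.+1)).
by move=> r _; exact: bellman_at_norm.
Qed.

Lemma integrable_continuation j k y : nu.-integrable setT
  (EFin \o (fun x => mix K (density k y) x * bellman j k.+1 (y + x))).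
Proof.
have gK : mixing_density nu mu K (density k y).
  by apply: (post_density_mixing mu_concentrated mu_plus weight_fin) => //;
    exact: measurable_carrier.
have mK := measurable_carrier nu mu.
apply: (@le_integrable_EFin _ _ (measurableTypeR R) nu setT _ (mix K (density k y))) => //.
- apply: measurable_funM; first exact: measurable_mixture.
  apply: (@measurableT_comp _ _ _ _ (measurableTypeR R) _ (bellman j k.+1)).
    exact: measurable_bellman.
  exact: measurable_funD.
- move=> x _; rewrite ger0_norm; last first.
    by rewrite mulr_ge0 ?mixture_ge0 ?bellman_ge0.
  rewrite ler_piMr ?mixture_ge0//.
  exact: le_trans (bellman_le_risk _ _ _) (risk_le1 _ _).
- by apply: integrable_mixture => //; exact: carrier_natural_domain.
Qed.

End bellman_equation.

(** * Stopping times against the finite-horizon optimum *)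

Section stopping.
Context {R : realType} {d : measure_display} {Omega : measurableType d}.
Variables (nu : {sigma_finite_measure set (measurableTypeR R) -> \bar R})
  (mu : probability (measurableTypeR R) R) (theta0 c : R).
Hypothesis nu_neq0 : nu [set: R] <> 0%E.
Hypothesis mu_concentrated : mu (natural_domain nu)° = 1%E.
Hypothesis mu_plus : (0 < mu (supp_plus mu theta0) < 1)%E.
Hypothesis weight_fin : forall (n : nat) (y : R),
  (\int[mu]_(u in msupport mu) (weight nu n y u)%:E < +oo)%E.
Hypothesis c_gt0 : 0 < c.
Variables (X : nat -> {mfun Omega >-> measurableTypeR R}) (n : nat) (y : R)
  (P : probability Omega R).
Local Notation F := (obs_sigma_algebra X n).
Local Notation K := (carrier nu mu).
Local Notation density := (post_density nu mu).
Local Notation mix := (mixture nu mu).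
Local Notation Y := (partial_sum X n y).
Local Notation risk := (risk nu mu theta0).
Local Notation bellman := (bellman nu mu theta0 c).
Hypothesis law : forall j C, (forall i, measurable (C i)) ->
  (P (\bigcap_(i in `I_j) (X (n + i).+1 @^-1` C i)) =
   \int[mu]_u (density n y u * likelihood_prod nu j C u)%:E)%E.

Local Notation cont := (continuation nu mu theta0 c).

Lemma bellman_markov j k E : F k E ->
  (\int[P]_(w in E) (bellman j (n + k).+1 (Y k.+1 w))%:E =
   \int[P]_(w in E) (cont j (n + k) (Y k w))%:E)%E.
Proof.
move=> FE.
have Qk : prediction_formula nu mu X n y P k.
  move=> E' j' C.
  exact: (prediction_formula_all nu_neq0 mu_concentrated mu_plus weight_fin law).
pose f (z : R * R) := (bellman j (n + k).+1 (z.1 + z.2))%:E.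
have mf : measurable_fun [set: measurableTypeR R * measurableTypeR R] f.
  apply/measurable_EFinP; apply: (@measurableT_comp _ _ _ _ (measurableTypeR R) _
    (bellman j (n + k).+1)); last exact: measurable_funD.
  exact: (measurable_bellman nu_neq0 mu_concentrated mu_plus weight_fin c_gt0).
have b0 k' z := bellman_ge0 mu_concentrated mu_plus weight_fin c_gt0 j k' z.
have f0 z : (0 <= f z)%E by rewrite lee_fin.
have := prediction_markov nu_neq0 mu_concentrated mu_plus weight_fin Qk FE mf f0.
rewrite /f => H.
under eq_integral do rewrite partial_sumS.
rewrite H; apply: eq_integral => w _.
have i := integrable_continuation nu_neq0 mu_concentrated mu_plus weight_fin
  c_gt0 j (n + k) (Y k w).
rewrite /continuation /Rintegral fineK; last exact: integrable_fin_num i.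
by apply: eq_integral => x _; rewrite -EFinM mulrC.
Qed.

Lemma measurable_stopped (tau : Omega -> nat) (h : nat -> Omega -> R) :
  (forall k, measurable [set w | (tau w <= k)%N]) ->
  (forall i, measurable_fun setT (h i)) ->
  measurable_fun setT (fun w => h (tau w) w).
Proof.
move=> mtau mh _ B mB; rewrite setTI.
rewrite (_ : _ @^-1` B = \bigcup_k ([set w | (tau w <= k)%N] `&`
    ~` [set w | (tau w < k)%N] `&` (h k @^-1` B))); last first.
  apply/seteqP; split => w.
    by move=> Bw; exists (tau w) => //; split => //; split => //=; rewrite ltnn.
  move=> [k _ [[/= tk /negP kt] hk]].
  by rewrite /= (_ : tau w = k)//; apply/eqP; rewrite eqn_leq tk leqNgt.
apply: bigcup_measurable => k _; apply: measurableI; last first.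
  by rewrite -[X in measurable X]setTI; exact: mh.
apply: measurableI => //; apply: measurableC; case: k => [|k]; last exact: mtau.
by rewrite (_ : [set w | _] = set0)//; apply/seteqP; split.
Qed.

Definition stopped_cost (tau : Omega -> nat) w :=
  risk (n + tau w) (Y (tau w) w) + c * (tau w)%:R.

(* Cost of following [tau] up to time [k] and the optimal rule of the problem
   with horizon [N] from then on. *)
Definition interpolated_cost N k i w :=
  if (i < k)%N then risk (n + i) (Y i w) + c * i%:R
  else bellman (N - k) (n + k) (Y k w) + c * k%:R.

Let c0 j k z : 0 <= cont j k z.
Proof. exact: (continuation_ge0 mu_concentrated mu_plus weight_fin c_gt0). Qed.
Let b0 j k z : 0 <= bellman j k z.
Proof. exact: (bellman_ge0 mu_concentrated mu_plus weight_fin c_gt0). Qed.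
Let r0 k z : 0 <= risk k z.
Proof. exact: (risk_ge0 mu_concentrated mu_plus weight_fin). Qed.

Lemma interpolated_cost_ge0 N k i w : 0 <= interpolated_cost N k i w.
Proof.
by rewrite /interpolated_cost; case: ifP => _; rewrite addr_ge0// mulr_ge0// ltW.
Qed.

Lemma measurable_bellman_sum j k l :
  measurable_fun setT (fun w => bellman j k (Y l w)).
Proof.
apply: (@measurableT_comp _ _ _ _ (measurableTypeR R) _ (bellman j k)).
  exact: (measurable_bellman nu_neq0 mu_concentrated mu_plus weight_fin c_gt0).
exact: measurable_partial_sum.
Qed.

Lemma measurable_continuation_sum j k l :
  measurable_fun setT (fun w => cont j k (Y l w)).
Proof.
apply: (@measurableT_comp _ _ _ _ (measurableTypeR R) _ (cont j k)).
  exact: (measurable_continuation nu_neq0 mu_concentrated mu_plus weight_fin c_gt0).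
exact: measurable_partial_sum.
Qed.

Lemma measurable_interpolated_cost N k i :
  measurable_fun setT (interpolated_cost N k i).
Proof.
(* Here [risk] is read as [bellman 0], whose measurability is already available. *)
rewrite (_ : interpolated_cost N k i = if (i < k)%N
    then (fun w => bellman 0 (n + i) (Y i w) + c * i%:R)
    else (fun w => bellman (N - k) (n + k) (Y k w) + c * k%:R)); last first.
  by apply/funext => w; rewrite /interpolated_cost; case: ifP.
by case: ifP => _; apply: measurable_funD => //; exact: measurable_bellman_sum.
Qed.

Lemma obs_stopping (tau : Omega -> nat) : stopping_time X n tau ->
  forall k, measurable [set w | (tau w <= k)%N].
Proof. by move=> st k; apply: measurable_obs (st k). Qed.

Let Z tau N k w := interpolated_cost N k (tau w) w.

Let mZ tau N k : stopping_time X n tau -> measurable_fun setT (Z tau N k).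
Proof.
move=> st; apply: measurable_stopped; first exact: obs_stopping.
exact: measurable_interpolated_cost.
Qed.

Let Z0 tau N k w : (0 <= (Z tau N k w)%:E)%E.
Proof. by rewrite lee_fin interpolated_cost_ge0. Qed.

Let split_integral tau N l k : stopping_time X n tau ->
  (\int[P]_w (Z tau N l w)%:E =
   \int[P]_(w in [set w | (tau w <= k)%N]) (Z tau N l w)%:E +
   \int[P]_(w in ~` [set w | (tau w <= k)%N]) (Z tau N l w)%:E)%E.
Proof.
move=> st; have mA := obs_stopping st k.
rewrite -ge0_integral_setU//.
- by rewrite setUv.
- exact: measurableC.
- by rewrite setUv; apply/measurable_EFinP; exact: mZ.
- by apply/disj_setPS; rewrite setICr.
Qed.

(* On [k < tau] both sides are continuation costs, related by the Markov
   property. *)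
Lemma integral_interpolatedS tau N k : stopping_time X n tau -> (k < N)%N ->
  (\int[P]_(w in ~` [set w | (tau w <= k)%N]) (Z tau N k.+1 w)%:E =
   \int[P]_(w in ~` [set w | (tau w <= k)%N])
     (c + cont (N - k.+1) (n + k) (Y k w) + c * k%:R)%:E)%E.
Proof.
move=> st kN.
have FE : F k (~` [set w | (tau w <= k)%N]) by apply: obs_setC; exact: st.
have mE := measurable_obs FE.
transitivity (\int[P]_(w in ~` [set w | (tau w <= k)%N])
    ((bellman (N - k.+1) (n + k).+1 (Y k.+1 w))%:E + (c * k.+1%:R)%:E))%E.
  apply: eq_integral => w /set_mem /= /negP; rewrite -ltnNge => kt.
  by rewrite /Z /interpolated_cost ltnNge kt/= -EFinD addnS.
have ck0 i : 0 <= c * i%:R by rewrite mulr_ge0// ltW.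
rewrite ge0_integralD//; last 3 first.
- by move=> w _; rewrite lee_fin.
- by apply/measurable_EFinP/measurable_funTS; exact: measurable_bellman_sum.
- by move=> w _; rewrite lee_fin.
rewrite bellman_markov//.
transitivity (\int[P]_(w in ~` [set w | (tau w <= k)%N])
    ((cont (N - k.+1) (n + k) (Y k w))%:E + (c * k.+1%:R)%:E))%E.
  rewrite ge0_integralD//.
  - by move=> w _; rewrite lee_fin.
  - by apply/measurable_EFinP/measurable_funTS; exact: measurable_continuation_sum.
  - by move=> w _; rewrite lee_fin.
apply: eq_integral => w _; rewrite -EFinD; congr EFin.
rewrite -natr1; move: (cont _ _ _) => v; ring.
Qed.

(** Following [tau] one step longer cannot help: on [tau = k] it pays the risk, on [k < tau] the
    continuation cost, and the Bellman minimum is at most either. *)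
Lemma interpolated_le_S tau N k : stopping_time X n tau -> (k < N)%N ->
  (\int[P]_w (Z tau N k w)%:E <= \int[P]_w (Z tau N k.+1 w)%:E)%E.
Proof.
move=> st kN; rewrite (split_integral N k k st) (split_integral N k.+1 k st).
have mA := obs_stopping st k.
apply: leeD.
- apply: ge0_le_integral => //.
  + by apply/measurable_EFinP/measurable_funTS; exact: mZ.
  + by apply/measurable_EFinP/measurable_funTS; exact: mZ.
  + move=> w /= tk; rewrite lee_fin /Z /interpolated_cost ltnS tk.
    move: tk; rewrite leq_eqVlt => /predU1P[->|->//].
    by rewrite ltnn lerD2r; exact: bellman_le_risk.
- rewrite integral_interpolatedS//; apply: ge0_le_integral => //.
  + exact: measurableC.
  + by apply/measurable_EFinP/measurable_funTS; exact: mZ.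
  + apply/measurable_EFinP/measurable_funTS; apply: measurable_funD => //.
    apply: measurable_funD => //; exact: measurable_continuation_sum.
  + move=> w /= /negP; rewrite -ltnNge => kt.
    rewrite lee_fin /Z /interpolated_cost ltnNge (ltnW kt)/= lerD2r.
    rewrite (_ : (N - k)%N = (N - k.+1).+1); last by rewrite subnSK.
    by rewrite /= ge_min lexx orbT.
Qed.

(** When [tau] selects the term attaining the Bellman minimum at time [k], the extra step costs
    nothing. *)
Lemma interpolated_ge_S tau N k : stopping_time X n tau -> (k < N)%N ->
  (forall w, tau w = k ->
    risk (n + k) (Y k w) <= bellman (N - k) (n + k) (Y k w)) ->
  (forall w, (k < tau w)%N ->
    bellman (N - k) (n + k) (Y k w) < risk (n + k) (Y k w)) ->
  (\int[P]_w (Z tau N k.+1 w)%:E <= \int[P]_w (Z tau N k w)%:E)%E.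
Proof.
move=> st kN stop go; rewrite (split_integral N k k st) (split_integral N k.+1 k st).
have mA := obs_stopping st k.
apply: leeD.
- apply: ge0_le_integral => //.
  + by apply/measurable_EFinP/measurable_funTS; exact: mZ.
  + by apply/measurable_EFinP/measurable_funTS; exact: mZ.
  + move=> w /= tk; rewrite lee_fin /Z /interpolated_cost ltnS tk.
    move: tk; rewrite leq_eqVlt => /predU1P[tk|->//].
    by rewrite tk ltnn lerD2r; exact: stop.
- rewrite integral_interpolatedS//; apply: ge0_le_integral => //.
  + exact: measurableC.
  + by move=> w _; rewrite lee_fin !addr_ge0// ?mulr_ge0// ltW.
  + apply/measurable_EFinP/measurable_funTS; apply: measurable_funD => //.
    apply: measurable_funD => //; exact: measurable_continuation_sum.
  + by apply/measurable_EFinP/measurable_funTS; exact: mZ.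
  + move=> w /= /negP; rewrite -ltnNge => kt.
    rewrite lee_fin /Z /interpolated_cost ltnNge (ltnW kt)/= lerD2r.
    have := go w kt.
    rewrite (_ : (N - k)%N = (N - k.+1).+1) /=; last by rewrite subnSK.
    by rewrite gt_min ltxx/= => /ltW h; rewrite le_min h lexx.
Qed.

Lemma bellman_le_stopped_cost tau N : stopping_time X n tau ->
  ((bellman N n y)%:E <=
   \int[P]_w (stopped_cost tau w)%:E + P [set w | (N < tau w)%N])%E.
Proof.
move=> st.
have mono k : (k <= N)%N -> ((bellman N n y)%:E <= \int[P]_w (Z tau N k w)%:E)%E.
  elim: k => [|k IH] kN; last first.
    exact: le_trans (IH (ltnW kN)) (interpolated_le_S st kN).
  rewrite /Z /interpolated_cost.
  under eq_integral do rewrite /= subn0 addn0 /partial_sum big_ord0 addr0 mulr0 addr0.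
  by rewrite integral_cst// [X in (_ * X)%E]probability_setT mule1.
apply: le_trans (mono N (leqnn N)) _.
have mtau : measurable [set w | (N < tau w)%N].
  rewrite (_ : [set w | _] = ~` [set w | (tau w <= N)%N]); last first.
    by apply/seteqP; split => w /=; rewrite ltnNge => /negP.
  by apply: measurableC; exact: obs_stopping.
have -> : (P [set w | (N < tau w)%N] =
    \int[P]_w (\1_[set w | (N < tau w)%N] w)%:E)%E by rewrite integral_indic// setIT.
rewrite -ge0_integralD//; last 3 first.
- by move=> w _; rewrite lee_fin addr_ge0// mulr_ge0// ltW.
- apply/measurable_EFinP.
  apply: (@measurable_stopped tau (fun i w => risk (n + i) (Y i w) + c * i%:R)).
    exact: obs_stopping.
  by move=> i; apply: measurable_funD => //; exact: (measurable_bellman_sum 0).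
- by apply/measurable_EFinP; exact: measurable_indic.
apply: ge0_le_integral => //.
- by apply/measurable_EFinP; exact: mZ.
- apply: emeasurable_funD; apply/measurable_EFinP; last exact: measurable_indic.
  apply: (@measurable_stopped tau (fun i w => risk (n + i) (Y i w) + c * i%:R)).
    exact: obs_stopping.
  by move=> i; apply: measurable_funD => //; exact: (measurable_bellman_sum 0).
move=> w _; rewrite -EFinD lee_fin /Z /interpolated_cost /stopped_cost subnn indicE.
have [tN|Nt] := ltnP (tau w) N; first by rewrite lerDl.
have [Ntw|tN] := ltnP N (tau w); last first.
  have -> : tau w = N by apply/eqP; rewrite eqn_leq tN Nt.
  by rewrite lerDl.
(* When [tau] exceeds [N], the interpolated cost stops at [N]; its risk is at most 1, which the
   indicator pays for, and its sampling cost is at most that of [tau]. *)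
rewrite mem_set//=; apply: (@le_trans _ _ (1 + c * (tau w)%:R)).
  apply: lerD; first exact: (risk_le1 mu_concentrated mu_plus weight_fin).
  by apply: ler_wpM2l; [exact: ltW|rewrite ler_nat].
by rewrite addrC -addrA lerDr.
Qed.

(** The first time before [N] at which stopping attains the Bellman minimum; [find] returns [N] when
    there is none, so the horizon is respected. *)
Definition optimal_rule N w :=
  find (fun k => risk (n + k) (Y k w) <= bellman (N - k) (n + k) (Y k w))
    (iota 0 N).

Let stop_at N k w := risk (n + k) (Y k w) <= bellman (N - k) (n + k) (Y k w).

Lemma optimal_rule_le N w : (optimal_rule N w <= N)%N.
Proof. by rewrite -{2}(size_iota 0 N) find_size. Qed.

Lemma optimal_rule_stop N w k : (k < N)%N -> optimal_rule N w = k ->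
  stop_at N k w.
Proof.
move=> kN tk; have hs : has (stop_at N ^~ w) (iota 0 N).
  by rewrite has_find size_iota -[X in (X < _)%N]/(optimal_rule N w) tk.
have := nth_find 0%N hs; rewrite -[find _ _]/(optimal_rule N w) tk.
by rewrite nth_iota.
Qed.

Lemma optimal_rule_continue N w k : (k < optimal_rule N w)%N -> ~~ stop_at N k w.
Proof.
move=> kt; have kN := leq_trans kt (optimal_rule_le N w).
have := before_find 0%N kt; rewrite nth_iota// add0n => h.
by apply/negPf; exact: h.
Qed.

Lemma obs_stop_at N k : F k [set w | stop_at N k w].
Proof.
have -> : [set w | stop_at N k w] =
    Y k @^-1` [set z | 0 <= bellman (N - k) (n + k) z - risk (n + k) z].
  by apply/seteqP; split => w /=; rewrite subr_ge0.
apply: obs_partial_sum.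
have mb : measurable_fun [set: measurableTypeR R]
    (fun z => bellman (N - k) (n + k) z - bellman 0 (n + k) z).
  apply: measurable_funB;
    exact: (measurable_bellman nu_neq0 mu_concentrated mu_plus weight_fin c_gt0).
have -> : [set z | 0 <= bellman (N - k) (n + k) z - risk (n + k) z] =
    (fun z => bellman (N - k) (n + k) z - bellman 0 (n + k) z) @^-1` `[0, +oo[.
  by apply/seteqP; split => z /=; rewrite in_itv/= andbT.
by rewrite -[X in measurable X]setTI; apply: mb => //; exact: measurable_itv.
Qed.

Lemma stopping_optimal_rule N : stopping_time X n (optimal_rule N).
Proof.
move=> k; have [Nk|kN] := leqP N k.
  rewrite (_ : [set w | _] = setT); first exact: obs_setT.
  by apply/seteqP; split => // w _; exact: leq_trans (optimal_rule_le N w) Nk.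
rewrite (_ : [set w | _] = \bigcup_(i in `I_k.+1) [set w | stop_at N i w]).
  apply: (@bigcup_measurable _ (g_sigma_algebraType (obs_events X n k))) => i /= ik.
  exact: (@obs_le _ _ _ X n i k _ ik (@obs_stop_at N i)).
apply/seteqP; split => w /=.
  move=> tk; exists (optimal_rule N w) => //=.
  by apply: optimal_rule_stop => //; exact: leq_ltn_trans tk kN.
move=> [i /= ik si]; rewrite leqNgt; apply/negP => kt.
have := optimal_rule_continue (@leq_ltn_trans k _ _ ik kt).
by rewrite si.
Qed.

Lemma optimal_rule_cost N :
  (\int[P]_w (stopped_cost (optimal_rule N) w)%:E <= (bellman N n y)%:E)%E.
Proof.
have st := stopping_optimal_rule N.
have mono k : (k <= N)%N ->
    (\int[P]_w (Z (optimal_rule N) N k w)%:E <= (bellman N n y)%:E)%E.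
  elim: k => [|k IH] kN; last first.
    apply: le_trans (IH (ltnW kN)); apply: interpolated_ge_S => // w tk.
      exact: optimal_rule_stop.
    by rewrite ltNge; exact: optimal_rule_continue.
  rewrite /Z /interpolated_cost.
  under eq_integral do rewrite /= subn0 addn0 /partial_sum big_ord0 addr0 mulr0 addr0.
  by rewrite integral_cst// [X in (_ * X)%E]probability_setT mule1.
apply: le_trans (mono N (leqnn N)).
rewrite le_eqVlt; apply/orP; left; apply/eqP; apply: eq_integral => w _.
congr EFin; rewrite /Z /interpolated_cost /stopped_cost subnn.
have [//|Nt] := ltnP (optimal_rule N w) N.
by have -> : optimal_rule N w = N by apply/eqP; rewrite eqn_leq optimal_rule_le.
Qed.

End stopping.

Lemma convex_function_itv01 {R : realType} (f : R -> R) :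
  @convex_function R R^o `[0, 1]%classic f ->
  convex01 f /\ exists M, forall r, 0 < r < 1 -> `|f r| <= M.
Proof.
move=> cf.
have cf' a b t : 0 <= a <= 1 -> 0 <= b <= 1 -> 0 <= t <= 1 ->
    f (t * a + (1 - t) * b) <= t * f a + (1 - t) * f b.
  move=> a01 b01 /andP[t0 t1].
  have := cf (Itv01 t0 t1) a b; rewrite !convRE/=; apply.
    by apply/mem_set; rewrite /= in_itv.
  by apply/mem_set; rewrite /= in_itv.
have cF : convex01 f by move=> a b t a01 b01; apply: cf'; lra.
split=> //; have h01 : 0 < (1 / 2 : R) < 1 by lra.
have [s sP] := convex01_subgradient cF h01.
(* The chord between 0 and 1 bounds [f] from above, the supporting line at 1/2 from below; the sum
   covers both. *)
exists (`|f (1 / 2)| + `|s| + `|f 0| + `|f 1|) => r r01.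
have := sP r r01; have := cf' 1 0 r ltac:(lra) ltac:(lra) ltac:(lra).
rewrite mulr1 mulr0 addr0 ler_norml => up low.
have nr (x : R) : - `|x| <= x <= `|x| by rewrite -ler_norml.
have := nr (f (1 / 2)); have := nr s; have := nr (f 0); have := nr (f 1).
move: up low; move: `|f (1 / 2)| `|s| `|f 0| `|f 1| (f (1 / 2)) (f 0) (f 1) (f r).
move=> h' s' z' o' h z o x up low o1 z1 s1 h1.
by apply/andP; split; nra.
Qed.

(** * Convex order between the next posterior probabilities *)

Section predictive_law.
Context {R : realType} {d : measure_display} {Omega : measurableType d}.
Variables (nu : {sigma_finite_measure set (measurableTypeR R) -> \bar R})
  (mu : probability (measurableTypeR R) R) (theta0 : R).
Hypothesis nu_neq0 : nu [set: R] <> 0%E.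
Hypothesis mu_concentrated : mu (natural_domain nu)° = 1%E.
Hypothesis mu_plus : (0 < mu (supp_plus mu theta0) < 1)%E.
Hypothesis weight_fin : forall (n : nat) (y : R),
  (\int[mu]_(u in msupport mu) (weight nu n y u)%:E < +oo)%E.
Variables (Theta : {mfun Omega >-> measurableTypeR R})
  (X : nat -> {mfun Omega >-> measurableTypeR R}).
Local Notation q := (post_prob nu mu theta0).
Local Notation level := (level nu mu theta0).
Local Notation value_next := (one_step nu mu theta0).

Lemma bayes_model_observations n p (P : probability Omega R) :
  bayes_model nu mu theta0 Theta X n p P ->
  forall j C, (forall i, measurable (C i)) ->
  (P (\bigcap_(i in `I_j) (X (n + i).+1 @^-1` C i)) =
   \int[mu]_u (post_density nu mu n (level n p) u * likelihood_prod nu j C u)%:E)%E.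
Proof.
move=> HP j C mC; have := HP j setT C (@measurableT _ _) mC.
by rewrite preimage_setT setTI.
Qed.

(** The Markov property at [k = 0] over the whole space; nonnegativity of [F] matches that of the
    integrands there. *)
Lemma expectation_next n p (P : probability Omega R) F (M : R) :
  bayes_model nu mu theta0 Theta X n p P ->
  convex01 F -> (forall r, 0 < r < 1 -> `|F r| <= M) ->
  (forall r, 0 < r < 1 -> 0 <= F r) ->
  (\int[P]_w (F (posterior_process nu mu theta0 X n p 1 w))%:E =
   (value_next F n (level n p))%:E)%E.
Proof.
move=> HP cF bF F0.
have law := bayes_model_observations HP.
have Q0 : prediction_formula nu mu X n (level n p) P 0.
  move=> E j C.
  exact: (prediction_formula_all nu_neq0 mu_concentrated mu_plus weight_fin law).
pose f (z : R * R) := (F (q n.+1 (z.1 + z.2)))%:E.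
have mf : measurable_fun [set: measurableTypeR R * measurableTypeR R] f.
  apply/measurable_EFinP; apply: (@measurableT_comp _ _ _ _ (measurableTypeR R) _
    (fun y => F (q n.+1 y))); last exact: measurable_funD.
  exact: (measurable_convex_post_prob mu_concentrated mu_plus weight_fin).
have f0 z : (0 <= f z)%E.
  by rewrite lee_fin F0// (post_prob01 mu_concentrated mu_plus weight_fin).
have H := prediction_markov nu_neq0 mu_concentrated mu_plus weight_fin Q0
  (@obs_setT _ _ _ X n 0) mf f0.
have i := integrable_one_step nu_neq0 mu_concentrated mu_plus weight_fin n
  (level n p) cF bF.
transitivity (\int[P]_w (f (partial_sum X n (level n p) 0 w, X (n + 0).+1 w)))%E.
  apply: eq_integral => w _; rewrite /f /posterior_process /partial_sum/=.
  by rewrite big_ord0 addr0 big_ord_recl big_ord0 addr0 addn1.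
rewrite H -[RHS]mule1 -(@probability_setT _ _ _ P) -integral_cst//.
apply: eq_integral => w _.
rewrite /one_step /Rintegral fineK; last exact: integrable_fin_num i.
rewrite /partial_sum big_ord0 addr0 addn0.
by apply: eq_integral => x _; rewrite /= perspective_mixture// -EFinM mulrC.
Qed.

Lemma measurable_next n p (F : R -> R) : convex01 F ->
  measurable_fun setT (fun w => F (posterior_process nu mu theta0 X n p 1 w)).
Proof.
move=> cF; apply: (@measurableT_comp _ _ _ _ (measurableTypeR R) _
  (fun y => F (q (n + 1) y))).
  exact: (measurable_convex_post_prob mu_concentrated mu_plus weight_fin).
exact: (@measurable_partial_sum _ _ _ X n (level n p) 1).
Qed.

Lemma next_dominates m n p (P P' : probability Omega R) :
  bayes_model nu mu theta0 Theta X m p P ->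
  bayes_model nu mu theta0 Theta X n p P' -> 0 < p < 1 -> (m <= n)%N ->
  convex_dominates P (posterior_process nu mu theta0 X m p 1)
    P' (posterior_process nu mu theta0 X n p 1).
Proof.
move=> HP HP' p01 mn f cf.
have [cF [M bF]] := convex_function_itv01 cf.
(* Adding the bound [M] makes the function nonnegative on the open interval and shifts both
   expectations equally. *)
pose F r := f r + M.
have cF' : convex01 F by move=> a b t a01 b01 t01; have := cF a b t a01 b01 t01; rewrite /F; lra.
have F0 r : 0 < r < 1 -> 0 <= F r.
  by move=> /bF; rewrite ler_norml /F; lra.
have bF' r : 0 < r < 1 -> `|F r| <= M + M.
  by move=> r01; have := bF r r01; have := F0 r r01; rewrite !ler_norml /F; lra.
have shift k (Q : probability Omega R) :
    (\int[Q]_w (F (posterior_process nu mu theta0 X k p 1 w))%:E =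
     'E_Q[f \o posterior_process nu mu theta0 X k p 1] + M%:E)%E.
  rewrite /F expectation.unlock.
  under eq_integral do rewrite EFinD.
  have iM : Q.-integrable setT (EFin \o fun=> M).
    exact: finite_measure_integrable_cst.
  have if_ : Q.-integrable setT
      (EFin \o (fun w => f (posterior_process nu mu theta0 X k p 1 w))).
    apply: (le_integrable_EFin measurableT (measurable_next k p cF) _ iM) => w _.
    by apply: bF; exact: (post_prob01 mu_concentrated mu_plus weight_fin).
  rewrite (integralD measurableT if_ iM).
  by rewrite integral_cst// [X in (_ * X)%E]probability_setT mule1.
rewrite -(@leeD2rE _ M%:E _ _ isT) -(shift n P') -(shift m P).
rewrite (expectation_next HP cF' bF' F0) (expectation_next HP' cF' bF' F0) lee_fin.
apply: (one_step_antitone nu_neq0 mu_concentrated mu_plus weight_fin cF' bF' mn).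
by rewrite !(post_prob_level mu_concentrated mu_plus weight_fin).
Qed.

End predictive_law.

(** * Monotonicity of the value function by letting the horizon grow *)

Section value_monotone.
Context {R : realType} {d : measure_display} {Omega : measurableType d}.
Variables (nu : {sigma_finite_measure set (measurableTypeR R) -> \bar R})
  (mu : probability (measurableTypeR R) R) (theta0 c : R).
Hypothesis nu_neq0 : nu [set: R] <> 0%E.
Hypothesis mu_concentrated : mu (natural_domain nu)° = 1%E.
Hypothesis mu_plus : (0 < mu (supp_plus mu theta0) < 1)%E.
Hypothesis weight_fin : forall (n : nat) (y : R),
  (\int[mu]_(u in msupport mu) (weight nu n y u)%:E < +oo)%E.
Hypothesis c_gt0 : 0 < c.
Variables (Theta : {mfun Omega >-> measurableTypeR R})
  (X : nat -> {mfun Omega >-> measurableTypeR R})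
  (P : nat -> R -> probability Omega R).
Hypothesis P_model : forall (n : nat) (p : R), 0 < p < 1 ->
  bayes_model nu mu theta0 Theta X n p (P n p).
Local Notation level := (level nu mu theta0).
Local Notation value := (value nu mu theta0 X c P).

Lemma value_le_bellman N n p : 0 < p < 1 ->
  (value n p <= (bellman nu mu theta0 c N n (level n p))%:E)%E.
Proof.
move=> p01; have law := bayes_model_observations (P_model n p01).
apply: le_trans (optimal_rule_cost nu_neq0 mu_concentrated mu_plus weight_fin
  c_gt0 law N).
apply: ereal_inf_lbound; exists (optimal_rule nu mu theta0 c X n (level n p) N).
  move=> k.
  exact: (stopping_optimal_rule nu_neq0 mu_concentrated mu_plus weight_fin c_gt0).
by rewrite expectation.unlock.
Qed.

Lemma cvg_late_stopping n (Q : probability Omega R) (tau : Omega -> nat) :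
  stopping_time X n tau -> Q [set w | (N < tau w)%N] @[N --> \oo] --> 0%E.
Proof.
move=> st; have mN N : measurable [set w | (N < tau w)%N].
  rewrite (_ : [set w | _] = ~` [set w | (tau w <= N)%N]).
    by apply: measurableC; exact: measurable_obs (st N).
  by apply/seteqP; split => w /=; rewrite ltnNge => /negP.
have -> : 0%E = Q (\bigcap_N [set w | (N < tau w)%N]).
  rewrite (_ : \bigcap_N _ = set0) ?measure0//.
  by apply/seteqP; split => w //= /(_ (tau w) I); rewrite /= ltnn.
apply: nonincreasing_cvg_mu => //.
- by rewrite -ge0_fin_numE// fin_num_measure.
- exact: bigcapT_measurable.
- move=> i j ij; apply/subsetPset => w /=; exact: leq_ltn_trans.
Qed.

Lemma value_mono p m n : 0 < p < 1 -> (m <= n)%N -> (value m p <= value n p)%E.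
Proof.
move=> p01 mn; apply: le_ereal_inf_tmp => _ [tau st <-].
have law := bayes_model_observations (P_model n p01).
rewrite expectation.unlock; set cost := (X in (_ <= X)%E).
have cost0 : (0 <= cost)%E.
  apply: integral_ge0 => w _; rewrite lee_fin addr_ge0//.
    exact: (risk_ge0 mu_concentrated mu_plus weight_fin).
  by rewrite mulr_ge0// ltW.
(* The finite-horizon optimum at [m] is at most the one at [n], which [tau] can beat only by the
   probability of stopping after [N]. *)
have bound N : (value m p <= cost + P n p [set w | (N < tau w)%N])%E.
  apply: le_trans (value_le_bellman N m p01) _.
  apply: le_trans (bellman_le_stopped_cost nu_neq0 mu_concentrated mu_plus
    weight_fin c_gt0 law N st).
  by rewrite lee_fin; apply: (bellman_mono nu_neq0 mu_concentrated mu_plus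
    weight_fin c_gt0).
have late := @cvg_late_stopping n (P n p) tau st.
have : (cost + P n p [set w | (N < tau w)%N])%E @[N --> \oo] --> (cost + 0)%E.
  (* The cost may be infinite; its nonnegativity keeps the sum with the limit 0 well defined. *)
  apply: cvgeD late; last exact: cvg_cst.
  by rewrite ge0_adde_def// inE.
by rewrite adde0; apply: cvge_ge; exact: nearW bound.
Qed.

End value_monotone.

Theorem theorem5p3 (R : realType)
  (nu : {sigma_finite_measure set (measurableTypeR R) -> \bar R})
  (mu : probability (measurableTypeR R) R)
  (theta0 c : R) (h : R -> R)
  (d : measure_display) (Omega : measurableType d)
  (Theta : {mfun Omega >-> measurableTypeR R})
  (X : nat -> {mfun Omega >-> measurableTypeR R})
  (P : nat -> R -> probability Omega R)
  (nu_neq0 : nu [set: R] <> 0%E)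
  (mu_concentrated : mu (natural_domain nu)° = 1%E)
  (mu_plus : (0 < mu (supp_plus mu theta0) < 1)%E)
  (weight_fin : forall (n : nat) (y : R),
     (\int[mu]_(u in msupport mu) (weight nu n y u)%:E < +oo)%E)
  (P_model : forall (n : nat) (p : R), 0 < p < 1 ->
     bayes_model nu mu theta0 Theta X n p (P n p))
  (c_gt0 : 0 < c)
  (h_ge0 : forall x, 0 <= h x)
  (nu_density : forall A : set (measurableTypeR R), measurable A ->
     nu A = (\int[lebesgue_measure]_(x in A) (h x)%:E)%E)
  (I_interval : is_interval [set x | 0 < h x])
  (h_continuous : {within [set x | 0 < h x], continuous h})
  (monotone_case :
     ((forall u, msupport mu u -> natural_domain nu u ->
         forall x y, 0 < h x -> 0 < h y -> x <= y ->
           h x * expdens nu u x <= h y * expdens nu u y) /\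
      (exists a, supp_plus mu theta0 = [set a]))
     \/
     ((forall u, msupport mu u -> natural_domain nu u ->
         forall x y, 0 < h x -> 0 < h y -> x <= y ->
           h y * expdens nu u y <= h x * expdens nu u x) /\
      (exists a, supp_minus mu theta0 = [set a]))) :
  (forall (p : R) (m n : nat), 0 < p < 1 -> (m <= n)%N ->
     convex_dominates
       (P m p) (posterior_process nu mu theta0 X m p 1)
       (P n p) (posterior_process nu mu theta0 X n p 1)) /\
  (forall (p : R) (m n : nat), 0 < p < 1 -> (m <= n)%N ->
     (value nu mu theta0 X c P m p <= value nu mu theta0 X c P n p)%E).
Proof.
split=> p m n p01 mn.
  exact: (next_dominates nu_neq0 mu_concentrated mu_plus weight_fin
    (P_model m p p01) (P_model n p p01) p01 mn).
exact: (value_mono nu_neq0 mu_concentrated mu_plus weight_fin c_gt0 P_model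
  p01 mn).
Qed.
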